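(* Let $u\in\mathcal{U}(\Pi_{k\to\omega}M_{n_k})$ be a unitary. For each positive integer $i$ with prime decomposition $i=a_1^{r_1}\cdots a_t^{r_t}$ (distinct primes $a_1,\dots,a_t$, exponents $r_j\geqslant 1$; $t=0$ if $i=1$), define $$c_i=\sum_{(\varepsilon_1,\ldots,\varepsilon_t)\in\{0,1\}^t}(-1)^{\varepsilon_1+\cdots+\varepsilon_t}\,Tr\big(u^{a_1^{r_1-\varepsilon_1}\cdots a_t^{r_t-\varepsilon_t}}\big)$$ (so $c_1=Tr(u)$). Then $u$ is conjugated to an element of $\Pi_{k\to\omega}P_{n_k}$ if and only if $c_i\geqslant 0$ (in particular $c_i$ is real) for every positive integer $i$.
   Context: $M_n=M_n(\mathbb{C})$ and $P_n\subset M_n$ is the group of permutation matrices. On $M_n$ put $Tr(A)=\frac1n\sum_i a_{ii}$ and $\|A\|_2=\sqrt{Tr(A^*A)}$. Fix a free ultrafilter $\omega$ on $\mathbb{N}$ and a sequence $(n_k)_k$ of positive integers with $\lim_k n_k=\infty$. Define $\Pi_{k\to\omega}M_{n_k}=l^\infty(\mathbb{N},M_{n_k})/\mathcal{N}_\omega$, where $l^\infty(\mathbb{N},M_{n_k})$ is the algebra of sequences $(x_k)$, $x_k\in M_{n_k}$, bounded in operator norm, and $\mathcal{N}_\omega=\{(x_k):\lim_{k\to\omega}\|x_k\|_2=0\}$. The class of $(x_k)$ is denoted $\Pi_{k\to\omega}x_k$, and $Tr(\Pi_{k\to\omega}x_k)=\lim_{k\to\omega}Tr(x_k)$. $\Pi_{k\to\omega}P_{n_k}$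 is the subgroup of elements having a representative $(p_k)$ with $p_k\in P_{n_k}$ for all $k$. For a unital $*$-algebra $A$, $\mathcal{U}(A)$ denotes its set of unitaries. Two elements $x,y$ of $\Pi_{k\to\omega}M_{n_k}$ are conjugated if $y=wxw^*$ for some $w\in\mathcal{U}(\Pi_{k\to\omega}M_{n_k})$. *)

(* Defs.v *)
From HB Require Import structures.
From mathcomp Require Import all_boot all_order all_algebra.
From mathcomp Require Import generic_quotient ring_quotient complex.
From mathcomp Require Import all_classical all_reals all_analysis.
From mathcomp Require Import ring lra.
Import Order.TTheory GRing.Theory Num.Theory numFieldNormedType.Exports.
Import ComplexField.Normc.

Set Implicit Arguments.
Unset Strict Implicit.
Unset Printing Implicit Defensive.

Local Open Scope classical_set_scope.
Local Open Scope ring_scope.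

Section MatrixNorms.
Variable R : realType.
Local Notation C := R[i].

Definition adjmx m n (A : 'M[C]_(m, n)) : 'M[C]_(n, m) := map_mx conjc A^T.

Definition ntr n (A : 'M[C]_n) : C := \tr A / n%:R.

Definition norm2 n (A : 'M[C]_n) : R := Num.sqrt (complex.Re (ntr (adjmx A *m A))).

Definition enorm n (v : 'cV[C]_n) : R := Num.sqrt (\sum_i normc (v i 0) ^+ 2).

Definition opnorm n (A : 'M[C]_n) : R :=
  sup [set enorm (A *m v) | v in [set v | enorm v <= 1]].

End MatrixNorms.

Section MatrixNormsTheory.
Variable R : realType.
Local Notation C := R[i].
Implicit Types I : finType.

Definition l2 I (f : I -> C) : R := Num.sqrt (\sum_i normc (f i) ^+ 2).

Lemma normc_ge0 (z : C) : 0 <= normc z.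
Proof. by case: z => a b; exact: sqrtr_ge0. Qed.

Lemma l2_ge0 I (f : I -> C) : 0 <= l2 f. Proof. exact: sqrtr_ge0. Qed.

Lemma l2_sqr I (f : I -> C) : l2 f ^+ 2 = \sum_i normc (f i) ^+ 2.
Proof. by rewrite sqr_sqrtr// sumr_ge0// => i _; rewrite sqr_ge0. Qed.

Lemma normc_sum I (f : I -> C) : normc (\sum_i f i) <= \sum_i normc (f i).
Proof.
elim/big_ind2: _ => [|x a y b xa yb|//]; first by rewrite normc0.
by apply: le_trans (le_normcD _ _) _; rewrite lerD.
Qed.

Lemma real_CS I (a b : I -> R) :
  (\sum_i a i * b i) ^+ 2 <= (\sum_i a i ^+ 2) * (\sum_i b i ^+ 2).
Proof.
have : 0 <= \sum_i \sum_j (a i * b j - a j * b i) ^+ 2.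
  by do 2!apply: sumr_ge0 => ? _; rewrite sqr_ge0.
have -> : \sum_i \sum_j (a i * b j - a j * b i) ^+ 2 =
    (\sum_i a i ^+ 2) * (\sum_i b i ^+ 2) + (\sum_i b i ^+ 2) * (\sum_i a i ^+ 2)
    - ((\sum_i a i * b i) * (\sum_i a i * b i)
       + (\sum_i a i * b i) * (\sum_i a i * b i)).
  rewrite !big_distrlr /= -!big_split -sumrB; apply: eq_bigr => i _ /=.
  rewrite -!big_split -sumrB; apply: eq_bigr => j _ /=; ring.
by rewrite expr2; lra.
Qed.

Lemma l2_CS I (f g : I -> C) : normc (\sum_i f i * g i) <= l2 f * l2 g.
Proof.
apply: le_trans (normc_sum _) _.
rewrite -ler_sqr ?nnegrE ?mulr_ge0 ?l2_ge0 ?sumr_ge0// => [|i _]; last exact: normc_ge0.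
rewrite exprMn !l2_sqr; apply: le_trans (real_CS _ _).
by under eq_bigr do rewrite normcM.
Qed.

Lemma l2D I (f g : I -> C) : l2 (fun i => f i + g i) <= l2 f + l2 g.
Proof.
rewrite -ler_sqr ?nnegrE ?addr_ge0 ?l2_ge0// sqrrD !l2_sqr.
pose a i := normc (f i); pose b i := normc (g i).
have ab : \sum_i a i * b i <= l2 f * l2 g.
  rewrite -ler_sqr ?nnegrE ?mulr_ge0 ?l2_ge0 ?sumr_ge0//.
    by rewrite exprMn !l2_sqr; exact: real_CS.
  by move=> i _; rewrite mulr_ge0 ?normc_ge0.
have : \sum_i normc (f i + g i) ^+ 2 <= \sum_i (a i ^+ 2 + (a i * b i + a i * b i) + b i ^+ 2).
  apply: ler_sum => i _; rewrite -mulr2n -sqrrD ler_sqr ?nnegrE ?addr_ge0 ?normc_ge0//.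
  exact: le_normcD.
rewrite !big_split /=; lra.
Qed.

Lemma l2Z I (c : C) (f : I -> C) : l2 (fun i => c * f i) = normc c * l2 f.
Proof.
rewrite /l2; under eq_bigr do rewrite normcM exprMn.
by rewrite -mulr_sumr sqrtrM ?sqr_ge0// sqrtr_sqr ger0_norm// normc_ge0.
Qed.

Lemma enormE n (v : 'cV[C]_n) : enorm v = l2 (fun i => v i 0). Proof. by []. Qed.

Lemma enorm_ge0 n (v : 'cV[C]_n) : 0 <= enorm v. Proof. exact: sqrtr_ge0. Qed.

Lemma enorm0 n : enorm (0 : 'cV[C]_n) = 0.
Proof.
by rewrite /enorm big1 ?sqrtr0// => i _; rewrite mxE normc0 expr0n.
Qed.

Lemma enorm_eq0 n (v : 'cV[C]_n) : enorm v = 0 -> v = 0.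
Proof.
move=> /eqP; rewrite -sqrf_eq0 l2_sqr psumr_eq0 => [/allP h|i _]; last exact: sqr_ge0.
apply/colP => i; rewrite mxE; apply: eq0_normc; apply/eqP.
by have := h i (mem_index_enum _); rewrite sqrf_eq0.
Qed.

Lemma enormD n (v w : 'cV[C]_n) : enorm (v + w) <= enorm v + enorm w.
Proof. by apply: le_trans (l2D _ _); rewrite enormE /l2; under eq_bigr do rewrite mxE. Qed.

Lemma enormZ n c (v : 'cV[C]_n) : enorm (c *: v) = normc c * enorm v.
Proof. by rewrite !enormE -l2Z /l2; under eq_bigr do rewrite mxE. Qed.

Definition frob m n (A : 'M[C]_(m, n)) : R :=
  Num.sqrt (\sum_i \sum_j normc (A i j) ^+ 2).

Lemma frob_l2 m n (A : 'M[C]_(m, n)) : frob A = l2 (fun p : 'I_m * 'I_n => A p.1 p.2).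
Proof. by rewrite /frob pair_bigA. Qed.

Lemma frob_ge0 m n (A : 'M[C]_(m, n)) : 0 <= frob A. Proof. exact: sqrtr_ge0. Qed.

Lemma frob_sqr m n (A : 'M[C]_(m, n)) : frob A ^+ 2 = \sum_i \sum_j normc (A i j) ^+ 2.
Proof. by rewrite frob_l2 l2_sqr pair_bigA. Qed.

Lemma frob_cols m n (A : 'M[C]_(m, n)) : frob A ^+ 2 = \sum_j enorm (col j A) ^+ 2.
Proof.
rewrite frob_sqr exchange_big; apply: eq_bigr => j _ /=; rewrite l2_sqr.
by apply: eq_bigr => i _; rewrite mxE.
Qed.

Lemma frobD m n (A B : 'M[C]_(m, n)) : frob (A + B) <= frob A + frob B.
Proof. by rewrite !frob_l2; apply: le_trans (l2D _ _); rewrite /l2; under eq_bigr do rewrite mxE. Qed.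

Lemma frobZ m n c (A : 'M[C]_(m, n)) : frob (c *: A) = normc c * frob A.
Proof. by rewrite !frob_l2 -l2Z /l2; under eq_bigr do rewrite mxE. Qed.

Lemma normc_conj (z : C) : normc (conjc z) = normc z.
Proof. by case: z => a b /=; rewrite sqrrN. Qed.

Lemma mul_conjc (z : C) : conjc z * z = (normc z ^+ 2)%:C%C.
Proof.
case: z => a b; rewrite /= sqr_sqrtr ?addr_ge0 ?sqr_ge0//; simpc.
by rewrite -!expr2 [b * a]mulrC addrN.
Qed.

Lemma frob_adj m n (A : 'M[C]_(m, n)) : frob (adjmx A) = frob A.
Proof.
rewrite /frob exchange_big /=; congr Num.sqrt.
by apply: eq_bigr => i _; apply: eq_bigr => j _; rewrite !mxE normc_conj.
Qed.

Lemma norm2E n (A : 'M[C]_n) : norm2 A = frob A / Num.sqrt n%:R.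
Proof.
rewrite /norm2; have -> : ntr (adjmx A *m A) = (frob A ^+ 2 / n%:R)%:C%C.
  rewrite rmorphM fmorphV rmorph_nat frob_sqr exchange_big rmorph_sum; congr (_ / _).
  apply: eq_bigr => i _; rewrite mxE rmorph_sum; apply: eq_bigr => j _.
  by rewrite !mxE mul_conjc.
by rewrite /= sqrtrM ?sqr_ge0// sqrtr_sqr ger0_norm ?frob_ge0// sqrtrV.
Qed.

Lemma norm2_ge0 n (A : 'M[C]_n) : 0 <= norm2 A. Proof. exact: sqrtr_ge0. Qed.

Lemma norm20 n : norm2 (0 : 'M[C]_n) = 0.
Proof.
rewrite norm2E /frob big1 ?sqrtr0 ?mul0r// => i _.
by rewrite big1// => j _; rewrite mxE normc0 expr0n.
Qed.

Lemma norm2D n (A B : 'M[C]_n) : norm2 (A + B) <= norm2 A + norm2 B.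
Proof. by rewrite !norm2E -mulrDl ler_wpM2r ?invr_ge0 ?sqrtr_ge0// frobD. Qed.

Lemma norm2Z n c (A : 'M[C]_n) : norm2 (c *: A) = normc c * norm2 A.
Proof. by rewrite !norm2E frobZ mulrA. Qed.

Lemma norm2N n (A : 'M[C]_n) : norm2 (- A) = norm2 A.
Proof. by rewrite -scaleN1r norm2Z normcN normc1 mul1r. Qed.

Lemma norm2_adj n (A : 'M[C]_n) : norm2 (adjmx A) = norm2 A.
Proof. by rewrite !norm2E frob_adj. Qed.

Lemma ntr_le n (A : 'M[C]_n) : normc (ntr A) <= norm2 A.
Proof.
have nn : normc (n%:R : C) = n%:R by rewrite [LHS]normcMn normc1.
rewrite norm2E normcM normcV nn.
have [n0|n0] := posnP n.
  by rewrite [in n%:R^-1]n0 [X in Num.sqrt X%:R]n0 invr0 mulr0 sqrtr0 invr0 mulr0.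
have -> : (n%:R : R)^-1 = (Num.sqrt n%:R)^-1 * (Num.sqrt n%:R)^-1.
  by rewrite -invfM -expr2 sqr_sqrtr.
rewrite mulrA ler_wpM2r ?invr_ge0 ?sqrtr_ge0//.
rewrite ler_pdivrMr ?sqrtr_gt0 ?ltr0n//.
have := @l2_CS _ (fun i => A i i) (fun i => 1).
rewrite /mxtrace; under eq_bigr do rewrite mulr1.
move/le_trans; apply.
have -> : l2 (fun _ : 'I_n => 1) = Num.sqrt n%:R.
  by rewrite /l2 normc1 expr1n sumr_const card_ord.
rewrite ler_wpM2r ?sqrtr_ge0// ler_wsqrtr//; apply: ler_sum => i _.
by rewrite (bigD1 i)//= lerDl sumr_ge0// => j _; rewrite sqr_ge0.
Qed.

Lemma enorm_frob n (A : 'M[C]_n) (v : 'cV[C]_n) : enorm (A *m v) <= frob A * enorm v.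
Proof.
rewrite -ler_sqr ?nnegrE ?mulr_ge0 ?frob_ge0 ?enorm_ge0// exprMn frob_sqr.
rewrite {1}enormE l2_sqr mulr_suml; apply: ler_sum => i _.
rewrite mxE.
rewrite -(l2_sqr (fun j => A i j)) -exprMn ler_sqr.
- exact: (@l2_CS _ (fun j => A i j) (fun j => v j 0)).
- by rewrite nnegrE normc_ge0.
- by rewrite nnegrE mulr_ge0 ?l2_ge0 ?enorm_ge0.
Qed.

Lemma has_sup_opnorm n (A : 'M[C]_n) :
  has_sup [set enorm (A *m v) | v in [set v | enorm v <= 1]].
Proof.
split; first by exists (enorm (A *m 0)), 0 => //=; rewrite enorm0.
exists (frob A) => _ [v /= v1 <-]; apply: le_trans (enorm_frob _ _) _.
by rewrite ler_piMr ?frob_ge0.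
Qed.

Lemma opnorm_ge0 n (A : 'M[C]_n) : 0 <= opnorm A.
Proof.
apply: ub_le_sup; first by case: (has_sup_opnorm A).
by exists 0; rewrite /= ?mulmx0 enorm0.
Qed.

Lemma opnorm_ub n (A : 'M[C]_n) v : enorm (A *m v) <= opnorm A * enorm v.
Proof.
have [v0|v0] := eqVneq (enorm v) 0.
  by rewrite (enorm_eq0 v0) mulmx0 enorm0 mulr0.
have vgt0 : 0 < enorm v by rewrite lt_neqAle eq_sym v0 enorm_ge0.
have nv : normc ((enorm v)^-1%:C%C) = (enorm v)^-1.
  by rewrite /= expr0n addr0 sqrtr_sqr ger0_norm// invr_ge0 enorm_ge0.
have : enorm (A *m ((enorm v)^-1%:C%C *: v)) <= opnorm A.
  apply: ub_le_sup; first by case: (has_sup_opnorm A).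
  by exists ((enorm v)^-1%:C%C *: v) => //=; rewrite enormZ nv mulVf.
by rewrite -scalemxAr enormZ nv mulrC ler_pdivrMr.
Qed.

Lemma opnorm_le n (A : 'M[C]_n) M :
  0 <= M -> (forall v, enorm (A *m v) <= M * enorm v) -> opnorm A <= M.
Proof.
move=> M0 AM; apply: ge_sup; first by case: (has_sup_opnorm A).
by move=> _ [v /= v1 <-]; apply: le_trans (AM v) _; rewrite ler_piMr.
Qed.

Lemma opnorm1 n : opnorm (1%:M : 'M[C]_n) <= 1.
Proof. by apply: opnorm_le => // v; rewrite mul1mx mul1r. Qed.

Lemma opnormD n (A B : 'M[C]_n) : opnorm (A + B) <= opnorm A + opnorm B.
Proof.
apply: opnorm_le => [|v]; first by rewrite addr_ge0 ?opnorm_ge0.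
by rewrite mulmxDl mulrDl; apply: le_trans (enormD _ _) _; rewrite lerD ?opnorm_ub.
Qed.

Lemma opnormM n (A B : 'M[C]_n) : opnorm (A *m B) <= opnorm A * opnorm B.
Proof.
apply: opnorm_le => [|v]; first by rewrite mulr_ge0 ?opnorm_ge0.
rewrite -mulmxA -mulrA; apply: le_trans (opnorm_ub _ _) _.
by rewrite ler_wpM2l ?opnorm_ge0 ?opnorm_ub.
Qed.

Lemma opnormZ n c (A : 'M[C]_n) : opnorm (c *: A) <= normc c * opnorm A.
Proof.
apply: opnorm_le => [|v]; first by rewrite mulr_ge0 ?opnorm_ge0 ?normc_ge0.
by rewrite -scalemxAl enormZ -mulrA ler_wpM2l ?normc_ge0 ?opnorm_ub.
Qed.

Lemma adjmxK m n : cancel (@adjmx R m n) (@adjmx R n m).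
Proof. by move=> A; apply/matrixP => i j; rewrite !mxE conjcK. Qed.

Lemma adjmxM m n p (A : 'M[C]_(m, n)) (B : 'M[C]_(n, p)) :
  adjmx (A *m B) = adjmx B *m adjmx A.
Proof. by rewrite /adjmx trmx_mul map_mxM. Qed.

Lemma adjmxD m n : {morph @adjmx R m n : A B / A + B}.
Proof. by move=> A B; apply/matrixP => i j; rewrite !mxE rmorphD. Qed.

Lemma adjmxN m n : {morph @adjmx R m n : A / - A}.
Proof. by move=> A; apply/matrixP => i j; rewrite !mxE rmorphN. Qed.

Lemma adjmxZ m n c (A : 'M[C]_(m, n)) : adjmx (c *: A) = conjc c *: adjmx A.
Proof. by apply/matrixP => i j; rewrite !mxE rmorphM. Qed.

Lemma adjmx1 n : adjmx (1%:M : 'M[C]_n) = 1%:M.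
Proof. by rewrite /adjmx trmx1 map_mx1. Qed.

Lemma enorm_sqr n (v : 'cV[C]_n) : (enorm v ^+ 2)%:C%C = (adjmx v *m v) 0 0.
Proof.
by rewrite enormE l2_sqr rmorph_sum mxE; apply: eq_bigr => i _; rewrite !mxE mul_conjc.
Qed.

Lemma opnorm_adj_le n (A : 'M[C]_n) : opnorm (adjmx A) <= opnorm A.
Proof.
apply: opnorm_le => [|v]; first exact: opnorm_ge0.
have [->|w0] := eqVneq (enorm (adjmx A *m v)) 0.
  by rewrite mulr_ge0 ?opnorm_ge0 ?enorm_ge0.
have wgt0 : 0 < enorm (adjmx A *m v) by rewrite lt_neqAle eq_sym w0 enorm_ge0.
rewrite -(ler_pM2r wgt0) -expr2.
set w := adjmx A *m v.
have -> : enorm w ^+ 2 = normc ((adjmx v *m (A *m w)) 0 0).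
  rewrite -[A]adjmxK mulmxA -adjmxM -enorm_sqr.
  by rewrite /= expr0n addr0 sqrtr_sqr ger0_norm ?sqr_ge0.
rewrite mxE; apply: le_trans (l2_CS _ _) _.
have -> : l2 (fun j => adjmx v 0 j) = enorm v.
  by rewrite /enorm /l2; under eq_bigr do rewrite !mxE normc_conj.
by rewrite mulrC -mulrA [enorm v * _]mulrC mulrA ler_wpM2r ?enorm_ge0 ?opnorm_ub.
Qed.

Lemma opnorm_adj n (A : 'M[C]_n) : opnorm (adjmx A) = opnorm A.
Proof.
apply/le_anti/andP; split; first exact: opnorm_adj_le.
by have := opnorm_adj_le (adjmx A); rewrite adjmxK.
Qed.

Lemma norm2Ml n (A B : 'M[C]_n) : norm2 (A *m B) <= opnorm A * norm2 B.
Proof.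
rewrite !norm2E mulrA ler_wpM2r ?invr_ge0 ?sqrtr_ge0//.
rewrite -ler_sqr ?nnegrE ?mulr_ge0 ?opnorm_ge0 ?frob_ge0// exprMn !frob_cols.
rewrite mulr_sumr; apply: ler_sum => j _; rewrite -exprMn.
by rewrite ler_sqr ?nnegrE ?mulr_ge0 ?opnorm_ge0 ?enorm_ge0// !colE -mulmxA opnorm_ub.
Qed.

Lemma norm2Mr n (A B : 'M[C]_n) : norm2 (A *m B) <= norm2 A * opnorm B.
Proof.
by rewrite -norm2_adj adjmxM -[norm2 A]norm2_adj -[opnorm B]opnorm_adj mulrC norm2Ml.
Qed.

End MatrixNormsTheory.

Record free_ultrafilter (T : Type) := FreeUltrafilter {
  ultrafilter_sets :> set_system T;
  ultrafilter_ultra : UltraFilter ultrafilter_sets;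
  ultrafilter_free : \bigcap_(A in ultrafilter_sets) A = set0 }.

#[global] Existing Instance ultrafilter_ultra.

Definition mxseq (R : realType) (n : nat -> nat) := forall k, 'M[R[i]]_(n k).

Section MatrixSequences.
Variables (R : realType) (n : nat -> nat).
Local Notation C := R[i].
Implicit Types x y z : mxseq R n.

HB.instance Definition _ := Choice.copy (mxseq R n) (forall k, 'M[C]_(n k)).

Lemma mxseqP x y : (forall k, x k = y k) -> x = y.
Proof. exact: functional_extensionality_dep. Qed.

Definition mxseq_zero : mxseq R n := fun k => 0.
Definition mxseq_opp x : mxseq R n := fun k => - x k.
Definition mxseq_add x y : mxseq R n := fun k => x k + y k.
Definition mxseq_one : mxseq R n := fun k => 1%:M.
Definition mxseq_mul x y : mxseq R n := fun k => x k *m y k.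
Definition mxseq_scale (c : C) x : mxseq R n := fun k => c *: x k.

Fact mxseq_addA : associative mxseq_add.
Proof. by move=> x y z; apply: mxseqP => k; exact: addrA. Qed.
Fact mxseq_addC : commutative mxseq_add.
Proof. by move=> x y; apply: mxseqP => k; exact: addrC. Qed.
Fact mxseq_add0 : left_id mxseq_zero mxseq_add.
Proof. by move=> x; apply: mxseqP => k; exact: add0r. Qed.
Fact mxseq_addN : left_inverse mxseq_zero mxseq_opp mxseq_add.
Proof. by move=> x; apply: mxseqP => k; exact: addNr. Qed.

HB.instance Definition _ := GRing.isZmodule.Build (mxseq R n)
  mxseq_addA mxseq_addC mxseq_add0 mxseq_addN.

Fact mxseq_mulA : associative mxseq_mul.
Proof. by move=> x y z; apply: mxseqP => k; exact: mulmxA. Qed.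
Fact mxseq_mul1l : left_id mxseq_one mxseq_mul.
Proof. by move=> x; apply: mxseqP => k; exact: mul1mx. Qed.
Fact mxseq_mul1r : right_id mxseq_one mxseq_mul.
Proof. by move=> x; apply: mxseqP => k; exact: mulmx1. Qed.
Fact mxseq_mulDl : left_distributive mxseq_mul +%R.
Proof. by move=> x y z; apply: mxseqP => k; exact: mulmxDl. Qed.
Fact mxseq_mulDr : right_distributive mxseq_mul +%R.
Proof. by move=> x y z; apply: mxseqP => k; exact: mulmxDr. Qed.

HB.instance Definition _ := GRing.Zmodule_isPzRing.Build (mxseq R n)
  mxseq_mulA mxseq_mul1l mxseq_mul1r mxseq_mulDl mxseq_mulDr.

Fact mxseq_scaleA a b x :
  mxseq_scale a (mxseq_scale b x) = mxseq_scale (a * b) x.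
Proof. by apply: mxseqP => k; exact: scalerA. Qed.
Fact mxseq_scale1 : left_id 1 mxseq_scale.
Proof. by move=> x; apply: mxseqP => k; exact: scale1r. Qed.
Fact mxseq_scaleDr : right_distributive mxseq_scale +%R.
Proof. by move=> c x y; apply: mxseqP => k; exact: scalerDr. Qed.
Fact mxseq_scaleDl x : {morph mxseq_scale^~ x : a b / a + b}.
Proof. by move=> a b; apply: mxseqP => k; exact: scalerDl. Qed.

HB.instance Definition _ := GRing.Zmodule_isLmodule.Build C (mxseq R n)
  mxseq_scaleA mxseq_scale1 mxseq_scaleDr mxseq_scaleDl.

Definition bounded_mxseq : {pred mxseq R n} :=
  fun x => `[< exists M, forall k, opnorm (x k) <= M >].

Fact bounded_mxseq_subring : subring_closed bounded_mxseq.
Proof.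
split=> [|x y /asboolP[M xM] /asboolP[N yN]|x y /asboolP[M xM] /asboolP[N yN]].
- by apply/asboolP; exists 1 => k; exact: opnorm1.
- apply/asboolP; exists (M + normc (-1 : C) * N) => k.
  apply: le_trans (opnormD _ _) _; rewrite lerD// -scaleN1r.
  by apply: le_trans (opnormZ _ _) _; rewrite ler_wpM2l ?normc_ge0.
- apply/asboolP; exists (M * N) => k.
  by apply: le_trans (opnormM _ _) _; rewrite ler_pM ?opnorm_ge0.
Qed.

Fact bounded_mxseq_scale : GRing.scaler_closed bounded_mxseq.
Proof.
move=> c x /asboolP[M xM]; apply/asboolP; exists (normc c * M) => k.
by apply: le_trans (opnormZ _ _) _; rewrite ler_wpM2l ?normc_ge0.
Qed.

HB.instance Definition _ :=
  GRing.isSubringClosed.Build (mxseq R n) bounded_mxseq bounded_mxseq_subring.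
HB.instance Definition _ :=
  GRing.isScaleClosed.Build C (mxseq R n) bounded_mxseq bounded_mxseq_scale.

(* n k may be 0 here, so these rings carry only the pzRingType structure;
   compatibility of scaling with products is uprod_scaleAl and uprod_scaleAr. *)
Record linfty := Linfty {
  linfty_val : mxseq R n;
  linfty_bounded : linfty_val \in bounded_mxseq }.

HB.instance Definition _ := [isSub for linfty_val].
HB.instance Definition _ := [Choice of linfty by <:].
HB.instance Definition _ := 
  GRing.SubChoice_isSubPzRing.Build _ _ linfty bounded_mxseq_subring.
HB.instance Definition _ := [SubZmodule_isSubLmodule of linfty by <:].

Definition linfty_fun (x : linfty) (k : nat) : 'M[C]_(n k) := linfty_val x k.
Coercion linfty_fun : linfty >-> Funclass.

Fact adjmx_bounded (x : linfty) :
  ((fun k => adjmx (x k)) : mxseq R n) \in bounded_mxseq.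
Proof.
case: x => x /= /asboolP[M xM].
by apply/asboolP; exists M => k; rewrite opnorm_adj.
Qed.

Definition linfty_star (x : linfty) : linfty := Linfty (adjmx_bounded x).

Lemma linftyP (x y : linfty) : (forall k, x k = y k) -> x = y.
Proof. by move=> xy; apply: val_inj; exact: mxseqP. Qed.

Lemma linfty_opnorm (x : linfty) : exists M, forall k, opnorm (x k) <= M.
Proof. exact/asboolP/(linfty_bounded x). Qed.

End MatrixSequences.
Arguments linfty : clear implicits.

Local Open Scope quotient_scope.

Section Ultraproduct.
Variables (R : realType) (n : nat -> nat) (omega : free_ultrafilter nat).
Local Notation C := R[i].
Local Notation linfty := (linfty R n).
Implicit Types x y z : linfty.

Definition null_mxseq : {pred linfty} :=
  fun x => `[< norm2 (x k) @[k --> (omega : set_system nat)] --> (0 : R) >].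

Lemma null_mxseqP x : reflect (norm2 (x k) @[k --> (omega : set_system nat)] --> (0 : R))
  (x \in null_mxseq).
Proof. exact: asboolP. Qed.

Lemma null_squeeze x (f : nat -> R) : (forall k, norm2 (x k) <= f k) ->
  f k @[k --> (omega : set_system nat)] --> (0 : R) -> x \in null_mxseq.
Proof.
move=> xf f0; apply/null_mxseqP.
apply: (@squeeze_cvgr _ _ _ _ (fun _ : nat => 0) f) => //; last exact: cvg_cst.
by apply: nearW => k; rewrite norm2_ge0 xf.
Qed.

Fact null_zmod : zmod_closed null_mxseq.
Proof.
split=> [|x y /null_mxseqP x0 /null_mxseqP y0].
  by apply/null_mxseqP; under eq_fun do rewrite norm20; exact: cvg_cst.
apply: (@null_squeeze _ (fun k => norm2 (x k) + norm2 (y k))).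
  by move=> k; rewrite -[norm2 (y k)]norm2N norm2D.
by rewrite -[0 in X in _ --> X](addr0 0); exact: cvgD.
Qed.

HB.instance Definition _ := GRing.isZmodClosed.Build linfty null_mxseq null_zmod.

Lemma nullMl x y : y \in null_mxseq -> x * y \in null_mxseq.
Proof.
move=> /null_mxseqP y0; have [M xM] := linfty_opnorm x.
apply: (@null_squeeze _ (fun k => M * norm2 (y k))) => [k|].
  by apply: le_trans (norm2Ml _ _) _; rewrite ler_wpM2r ?norm2_ge0.
by rewrite -(mulr0 M); apply: cvgMr.
Qed.

Lemma nullMr x y : x \in null_mxseq -> x * y \in null_mxseq.
Proof.
move=> /null_mxseqP x0; have [M yM] := linfty_opnorm y.
apply: (@null_squeeze _ (fun k => M * norm2 (x k))) => [k|].
  by apply: le_trans (norm2Mr _ _) _; rewrite mulrC ler_wpM2r ?norm2_ge0.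
by rewrite -(mulr0 M); apply: cvgMr.
Qed.

Lemma nullZ (c : C) x : x \in null_mxseq -> c *: x \in null_mxseq.
Proof.
move=> /null_mxseqP x0.
apply: (@null_squeeze _ (fun k => normc c * norm2 (x k))) => [k|].
  by rewrite -norm2Z.
by rewrite -(mulr0 (normc c)); apply: cvgMr.
Qed.

Lemma null_star x : x \in null_mxseq -> linfty_star x \in null_mxseq.
Proof.
move=> /null_mxseqP x0; apply: (null_squeeze _ x0) => k.
by rewrite norm2_adj.
Qed.

Definition uprod : Type := Quotient.quot (null_mxseq : zmodClosed linfty).
HB.instance Definition _ := Choice.on uprod.
HB.instance Definition _ := GRing.Zmodule.on uprod.

Definition uclass x : uprod := \pi_uprod x.
Definition urep (a : uprod) : linfty := repr a.

Lemma uclassK a : uclass (urep a) = a. Proof. exact: reprK. Qed.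

Lemma uclass_eqP x y : uclass x = uclass y <-> x - y \in null_mxseq.
Proof. by rewrite Quotient.idealrBE; split=> [/eqP|/eqP]. Qed.

Lemma uclassD x y : uclass (x + y) = uclass x + uclass y.
Proof. by rewrite /uclass !piE. Qed.

Lemma urepK x : urep (uclass x) - x \in null_mxseq.
Proof. by apply/uclass_eqP; rewrite uclassK. Qed.

Definition uprod_one : uprod := uclass 1.
Definition uprod_mul (a b : uprod) : uprod := uclass (urep a * urep b).
Definition uprod_scale (c : C) (a : uprod) : uprod := uclass (c *: urep a).

Definition ustar (a : uprod) : uprod := uclass (linfty_star (urep a)).

(* The limit exists, by cvg_ntr, and depends only on the class, by utr_uclass. *)
Definition utr (a : uprod) : C :=
  lim ((ntr (urep a k) : C^o) @[k --> (omega : set_system nat)]).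

Lemma uclassMdef x y : uclass (x * y) = uprod_mul (uclass x) (uclass y).
Proof.
apply/esym/uclass_eqP.
rewrite -[X in X - _](subrK (urep (uclass x) * y)) -mulrBr -addrA -mulrBl.
by apply: rpredD; [exact: nullMl (urepK _)|exact: nullMr (urepK _)].
Qed.

Lemma uclassZdef c x : uclass (c *: x) = uprod_scale c (uclass x).
Proof. by apply/esym/uclass_eqP; rewrite -scalerBr; exact: nullZ (urepK _). Qed.

Lemma uclass_star x : uclass (linfty_star x) = ustar (uclass x).
Proof.
apply/esym/uclass_eqP.
have -> : linfty_star (urep (uclass x)) - linfty_star x
          = linfty_star (urep (uclass x) - x).
  apply: linftyP => k; rewrite /linfty_fun/= .
  by rewrite [RHS]adjmxD adjmxN.
exact: null_star (urepK _).
Qed.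

Fact uprod_mulA : associative uprod_mul.
Proof.
by move=> a b c; rewrite -[a]uclassK -[b]uclassK -[c]uclassK -!uclassMdef mulrA.
Qed.
Fact uprod_mul1l : left_id uprod_one uprod_mul.
Proof. by move=> a; rewrite -[a]uclassK -uclassMdef mul1r. Qed.
Fact uprod_mul1r : right_id uprod_one uprod_mul.
Proof. by move=> a; rewrite -[a]uclassK -uclassMdef mulr1. Qed.
Fact uprod_mulDl : left_distributive uprod_mul +%R.
Proof.
move=> a b c; rewrite -[a]uclassK -[b]uclassK -[c]uclassK.
by rewrite -!(uclassD, uclassMdef) mulrDl.
Qed.
Fact uprod_mulDr : right_distributive uprod_mul +%R.
Proof.
move=> a b c; rewrite -[a]uclassK -[b]uclassK -[c]uclassK.
by rewrite -!(uclassD, uclassMdef) mulrDr.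
Qed.

HB.instance Definition _ := GRing.Zmodule_isPzRing.Build uprod
  uprod_mulA uprod_mul1l uprod_mul1r uprod_mulDl uprod_mulDr.

Fact uprod_scaleA c d a :
  uprod_scale c (uprod_scale d a) = uprod_scale (c * d) a.
Proof. by rewrite -[a]uclassK -!uclassZdef scalerA. Qed.
Fact uprod_scale1 : left_id 1 uprod_scale.
Proof. by move=> a; rewrite -[a]uclassK -uclassZdef scale1r. Qed.
Fact uprod_scaleDr : right_distributive uprod_scale +%R.
Proof.
move=> c a b; rewrite -[a]uclassK -[b]uclassK.
by rewrite -!(uclassD, uclassZdef) scalerDr.
Qed.
Fact uprod_scaleDl a : {morph uprod_scale^~ a : c d / c + d}.
Proof. by move=> c d; rewrite -[a]uclassK -!uclassZdef -uclassD scalerDl. Qed.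

HB.instance Definition _ := GRing.Zmodule_isLmodule.Build C uprod
  uprod_scaleA uprod_scale1 uprod_scaleDr uprod_scaleDl.

Lemma uclass1 : uclass 1 = 1. Proof. by []. Qed.

Lemma uclassM x y : uclass (x * y) = uclass x * uclass y.
Proof. exact: uclassMdef. Qed.

Lemma uclassZ c x : uclass (c *: x) = c *: uclass x.
Proof. exact: uclassZdef. Qed.

Lemma uprod_scaleAl c (a b : uprod) : c *: (a * b) = c *: a * b.
Proof.
rewrite -[a]uclassK -[b]uclassK -!(uclassM, uclassZ); congr uclass.
by apply: linftyP => k; exact: scalemxAl.
Qed.

Lemma uprod_scaleAr c (a b : uprod) : c *: (a * b) = a * (c *: b).
Proof.
rewrite -[a]uclassK -[b]uclassK -!(uclassM, uclassZ); congr uclass.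
by apply: linftyP => k; exact: scalemxAr.
Qed.

Lemma ustarK : involutive ustar.
Proof.
move=> a; rewrite -[a]uclassK -!uclass_star; congr uclass.
by apply: linftyP => k; exact: adjmxK.
Qed.

Lemma ustarD : {morph ustar : a b / a + b}.
Proof.
move=> a b; rewrite -[a]uclassK -[b]uclassK -!(uclassD, uclass_star); congr uclass.
by apply: linftyP => k; exact: adjmxD.
Qed.

Lemma ustarM a b : ustar (a * b) = ustar b * ustar a.
Proof.
rewrite -[a]uclassK -[b]uclassK -!(uclassM, uclass_star); congr uclass.
by apply: linftyP => k; exact: adjmxM.
Qed.

Lemma ustarZ c a : ustar (c *: a) = conjc c *: ustar a.
Proof.
rewrite -[a]uclassK -!(uclassZ, uclass_star); congr uclass.
by apply: linftyP => k; exact: adjmxZ.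
Qed.

Lemma ustar1 : ustar 1 = 1.
Proof.
rewrite -uclass1 -uclass_star; congr uclass.
by apply: linftyP => k; exact: adjmx1.
Qed.

Lemma cvg_complex (f : nat -> C) (l : C) :
  normc (f k - l) @[k --> (omega : set_system nat)] --> (0 : R) ->
  (f k : C^o) @[k --> (omega : set_system nat)] --> (l : C^o).
Proof.
move=> fl; apply/cvgrPdist_lt => -[e e'].
rewrite ltcE /= => /andP[/eqP -> e0].
move/cvgrPdist_lt: fl => /(_ e e0); apply: filterS => k /=; rewrite sub0r normrN ger0_norm ?normc_ge0// => h.
by rewrite distrC [`|_|]normc_def ltcR; case: (f k - l) h.
Qed.

Lemma ultra_real_cvg (f : nat -> R) M : (forall k, `|f k| <= M) ->
  exists l, f k @[k --> (omega : set_system nat)] --> (l : R).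
Proof.
move=> fM.
have fI : (f k @[k --> (omega : set_system nat)]) `[- M, M]%classic.
  by apply: nearW => k /=; rewrite in_itv /= -ler_norml.
have [l [_ fl]] := @segment_compact R (- M) M _ _ fI.
exists l => B Bl.
have [//|nB] := in_ultra_setVsetC (f @^-1` B) (ultrafilter_ultra omega).
by have [y [/= nBy By]] := fl (~` B) B nB Bl.
Qed.

Lemma ntr_opnorm m (A : 'M[C]_m) : normc (ntr A) <= opnorm A.
Proof.
apply: le_trans (ntr_le A) _; rewrite -[A in norm2 A]mulmx1.
apply: le_trans (norm2Ml _ _) _; rewrite ler_piMr ?opnorm_ge0//.
rewrite norm2E frob_l2 /l2 (eq_bigr (fun p : 'I_m * 'I_m => (p.1 == p.2)%:R)); last first.
  by move=> -[i j] _ /=; rewrite mxE; case: eqP; rewrite ?normc1 ?normc0 ?expr1n ?expr0n.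
rewrite -(pair_bigA _ (fun i j => (i == j)%:R)) /=.
rewrite (eq_bigr (fun=> 1)); last first.
  by move=> i _; rewrite (bigD1 i)//= eqxx big1 ?addr0// => j; rewrite eq_sym => /negPf ->.
rewrite sumr_const card_ord; have [->|m0] := eqVneq (Num.sqrt m%:R : R) 0.
  by rewrite mul0r.
by rewrite divff.
Qed.

Lemma cvg_ntr_normc x : exists l : C,
  normc (ntr (x k) - l) @[k --> (omega : set_system nat)] --> (0 : R).
Proof.
have [M xM] := linfty_opnorm x.
have normc_ge (z : C) : `|complex.Re z| <= normc z /\ `|complex.Im z| <= normc z.
  case: z => a b /=; rewrite -!sqrtr_sqr !ler_wsqrtr//.
    by rewrite lerDr sqr_ge0.
  by rewrite lerDl sqr_ge0.
have xn k : normc (ntr (x k)) <= M by apply: le_trans (ntr_opnorm _) (xM k).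
have [k|a fa] := @ultra_real_cvg (fun k => complex.Re (ntr (x k))) M.
  exact: le_trans (normc_ge _).1 (xn k).
have [k|b fb] := @ultra_real_cvg (fun k => complex.Im (ntr (x k))) M.
  exact: le_trans (normc_ge _).2 (xn k).
exists (a +i* b)%C.
apply: (@squeeze_cvgr _ _ _ _ (fun=> 0)
  (fun k => `|complex.Re (ntr (x k)) - a| + `|complex.Im (ntr (x k)) - b|)).
- apply: nearW => k; rewrite normc_ge0 /=; case: (ntr (x k)) => c d /=.
  rewrite -ler_sqr ?nnegrE ?addr_ge0 ?sqrtr_ge0// sqr_sqrtr ?addr_ge0 ?sqr_ge0//.
  rewrite [X in _ <= X]sqrrD !real_normK ?num_real//.
  by have := mulr_ge0 (normr_ge0 (c - a)) (normr_ge0 (d - b)); lra.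
- exact: cvg_cst.
- have cvg0 (f : nat -> R) c : f k @[k --> (omega : set_system nat)] --> c ->
    `|f k - c| @[k --> (omega : set_system nat)] --> (0 : R).
    move=> fc; rewrite -(normr0 R) -(subrr c); apply: cvg_norm.
    by apply: cvgB => //; exact: cvg_cst.
  by rewrite -[0 in X in _ --> X](addr0 0); apply: cvgD; exact: cvg0.
Qed.

Lemma cvg_ntr x :
  exists l : C, (ntr (x k) : C^o) @[k --> (omega : set_system nat)] --> (l : C^o).
Proof. by have [l xl] := cvg_ntr_normc x; exists l; exact: cvg_complex. Qed.

Lemma utr_uclass x :
  utr (uclass x) = lim ((ntr (x k) : C^o) @[k --> (omega : set_system nat)]).
Proof.
have [l xl] := cvg_ntr_normc x.
rewrite (cvg_lim _ (cvg_complex xl))// /utr.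
suff h : normc (ntr (urep (uclass x) k) - l)
    @[k --> (omega : set_system nat)] --> (0 : R).
  by rewrite (cvg_lim _ (cvg_complex h)).
have /null_mxseqP x0 := urepK x.
apply: (@squeeze_cvgr _ _ _ _ (fun=> 0) (fun k =>
  norm2 ((urep (uclass x) - x) k) + normc (ntr (x k) - l))).
- apply: nearW => k; rewrite normc_ge0 /=.
  have -> : ntr (urep (uclass x) k) - l
      = ntr ((urep (uclass x) - x) k) + (ntr (x k) - l).
    rewrite addrA /ntr -mulrDl -mxtraceD; congr (\tr _ / _ - _).
    by rewrite -[RHS]/((urep (uclass x) - x + x) k) subrK.
  by apply: le_trans (le_normcD _ _) _; rewrite lerD2r ntr_le.
- exact: cvg_cst.
- by rewrite -[0 in X in _ --> X](addr0 0); exact: cvgD.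
Qed.
End Ultraproduct.

Arguments uprod : clear implicits.

Section Unitaries.
Variables (R : realType) (n : nat -> nat) (omega : free_ultrafilter nat).
Local Notation M := (uprod R n omega).

Definition unitary : set M := [set u | ustar u * u = 1 /\ u * ustar u = 1].

Definition uprod_perm : set M :=
  [set a | exists p : linfty R n,
     (forall k, is_perm_mx (p k)) /\ a = uclass omega p].

Definition conjugated (x y : M) : Prop :=
  exists2 w, unitary w & y = w * x * ustar w.

(* The numbers c_i. The j-th prime factor of i is nth 0 (primes i) j, its
   exponent is given by logn, and e j : bool is coerced to 0 or 1. *)
Definition ctrace (u : M) (i : nat) : R[i] :=
  let t := size (primes i) in
  let a (j : 'I_t) := nth 0%N (primes i) j in
  let r (j : 'I_t) := logn (a j) i in
  \sum_(e : {ffun 'I_t -> bool})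
     (-1) ^+ (\sum_j e j) * utr (u ^+ (\prod_j a j ^ (r j - e j))).

End Unitaries.

(* Main.v *)
Require Import Defs.
From mathcomp Require Import all_boot all_order all_algebra all_fingroup complex.
From mathcomp Require Import all_classical all_reals all_analysis.
From mathcomp Require Import ring lra spectral.
Import Order.TTheory GRing.Theory Num.Theory numFieldNormedType.Exports.
Import ComplexField.Normc.

Set Implicit Arguments.
Unset Strict Implicit.
Unset Printing Implicit Defensive.

Local Open Scope classical_set_scope.
Local Open Scope ring_scope.

(** The numbers [c_i] are the Moebius inverse, along divisibility, of the
    moments [m |-> Tr (u ^ m)]: inversion gives that [Tr (u ^ m)] is the sum of
    [c_d] over the divisors [d] of [m] ([divisor_difference_inversion]).

    For a permutation matrix of size [n], [Tr (p ^ m)] is the proportion of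
    points whose period divides [m], so [c_i] is the proportion of points of
    period [i] and is nonnegative ([divisor_difference_perm]). Moments are
    invariant under conjugation, and nonnegativity passes to the limit, which
    proves one direction.

    Conversely, nonnegative [c_i] add up to at most [1], and there are
    permutations whose proportion of points of period [d] tends to [c_d], the
    other points forming one long cycle ([perm_of_cycle_proportions]). The
    moments of the resulting element are those of [u]
    ([perm_of_nonneg_ctrace]). It remains to see that two unitaries of the
    ultraproduct with equal moments are conjugated
    ([conjugated_of_moments]).

    Unitaries of the ultraproduct lift to sequences of unitary matrices, by
    polar decomposition ([polar_approx], [unitary_lift]), and these can be
    diagonalized. So the question is whether two eigenvalue lists on the unit
    circle with asymptotically equal moments can be paired with small mean
    squared distance ([eigenvalue_matching]). To this end each eigenvalue [z]
    is moved to a nearby point chosen at random in a fixed finite set: the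
    average of [N] random steps of mean [z] ([random_walk]). The
    probabilities are trigonometric polynomials in [z], hence their averages
    over a list are determined by its moments and agree in the limit for both
    lists. A derandomization ([greedy_rounding]) moves each list to honest
    points, each point being used about as often by one list as by the other,
    and indices using the same point are then paired ([matching]). *)

(** * Unitary matrices and the normalized 2-norm *)

Section Spectral.
Variable R : realType.
Local Notation C := R[i].
Local Open Scope sesquilinear_scope.

Lemma adjmxE m n (A : 'M[C]_(m, n)) : adjmx A = A ^t*.
Proof. by apply/matrixP => i j; rewrite !mxE. Qed.

Definition unitary_mx n (A : 'M[C]_n) := adjmx A *m A = 1%:M.

Lemma unitary_mxC n (A : 'M[C]_n) : unitary_mx A -> A *m adjmx A = 1%:M.
Proof. exact: mulmx1C. Qed.

Lemma unitary_mx_adj n (A : 'M[C]_n) : unitary_mx A -> unitary_mx (adjmx A).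
Proof. by rewrite /unitary_mx adjmxK; exact: unitary_mxC. Qed.

Lemma unitary_mxM n (A B : 'M[C]_n) :
  unitary_mx A -> unitary_mx B -> unitary_mx (A *m B).
Proof.
move=> uA uB; rewrite /unitary_mx adjmxM -mulmxA [adjmx A *m _]mulmxA uA mul1mx.
exact: uB.
Qed.

Lemma unitary_mx_conjK n (U A : 'M[C]_n) : unitary_mx U ->
  U *m (adjmx U *m A *m U) *m adjmx U = A.
Proof.
move=> uU; rewrite !mulmxA unitary_mxC// mul1mx -mulmxA unitary_mxC//.
exact: mulmx1.
Qed.

Lemma spectral_decomposition n (A : 'M[C]_n) : A *m adjmx A = adjmx A *m A ->
  exists U (d : 'rV[C]_n), unitary_mx U /\ A = adjmx U *m diag_mx d *m U.
Proof.
move=> nA; have uA := spectral_unitarymx A.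
exists (spectralmx A), (spectral_diag A); split.
  by apply: mulmx1C; rewrite adjmxE; exact/unitarymxP.
rewrite adjmxE -(invmx_unitary uA).
by apply: orthomx_spectralP; apply/normalmxP; rewrite -adjmxE.
Qed.

Lemma opnorm_unitary n (A : 'M[C]_n) : unitary_mx A -> opnorm A <= 1.
Proof.
move=> uA; apply: opnorm_le => // v; rewrite mul1r.
rewrite -ler_sqr ?nnegrE ?enorm_ge0// -lecR !enorm_sqr adjmxM mulmxA.
by rewrite -[_ *m _ *m A]mulmxA uA mulmx1.
Qed.

Lemma norm2_unitary n (U A V : 'M[C]_n) : unitary_mx U -> unitary_mx V ->
  norm2 (U *m A *m V) <= norm2 A.
Proof.
move=> uU uV; apply: le_trans (norm2Mr _ _) _.
apply: (@le_trans _ _ (norm2 (U *m A))).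
  by rewrite ler_piMr ?norm2_ge0// opnorm_unitary.
by apply: le_trans (norm2Ml _ _) _; rewrite ler_piMl ?norm2_ge0// opnorm_unitary.
Qed.

Lemma adjmx_diag n (d : 'rV[C]_n) : adjmx (diag_mx d) = diag_mx (map_mx conjc d).
Proof. by rewrite /adjmx tr_diag_mx map_diag_mx. Qed.

Lemma conjc_normc1 (z : C) : normc z = 1 <-> conjc z * z = 1.
Proof.
rewrite mul_conjc; split=> [->|h]; first by rewrite expr1n.
have : normc z ^+ 2 = 1 by exact: complexI.
by move/eqP; rewrite sqrp_eq1 ?normc_ge0// => /eqP.
Qed.

Lemma diag_unitary n (d : 'rV[C]_n) : unitary_mx (diag_mx d) ->
  forall j, normc (d 0 j) = 1.
Proof.
rewrite /unitary_mx adjmx_diag mulmx_diag => /matrixP h j; apply/conjc_normc1.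
by have := h j j; rewrite !mxE eqxx mulr1n.
Qed.

Lemma unitary_diagonalization n (A : 'M[C]_n) : unitary_mx A ->
  exists U (d : 'rV[C]_n), [/\ unitary_mx U, forall j, normc (d 0 j) = 1
    & A = adjmx U *m diag_mx d *m U].
Proof.
move=> uA.
have [U [d [uU AE]]] := spectral_decomposition (etrans (unitary_mxC uA) (esym uA)).
exists U, d; split=> //; apply: diag_unitary.
rewrite -(unitary_mx_conjK (diag_mx d) uU) -AE.
apply: unitary_mxM (unitary_mx_adj uU); exact: unitary_mxM.
Qed.

Lemma norm2_diag n (d : 'rV[C]_n) :
  norm2 (diag_mx d) = Num.sqrt ((\sum_j normc (d 0 j) ^+ 2) / n%:R).
Proof.
rewrite norm2E sqrtrM ?sumr_ge0// => [|j _]; last exact: sqr_ge0.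
rewrite sqrtrV//; congr (Num.sqrt _ / _); apply: eq_bigr => i _.
rewrite (bigD1 i)//= big1 ?addr0; last first.
  by move=> j; rewrite eq_sym mxE => /negPf ->; rewrite normc0 expr0n.
by rewrite mxE eqxx mulr1n.
Qed.

Lemma norm2_1 n : norm2 (1%:M : 'M[C]_n) <= 1.
Proof.
rewrite -diag_const_mx norm2_diag.
under eq_bigr do rewrite mxE normc1 expr1n.
rewrite sumr_const card_ord; have [->|n0] := eqVneq (n%:R : R) 0.
  by rewrite mul0r sqrtr0.
by rewrite divff// sqrtr1.
Qed.

Lemma normcR (x : R) : normc x%:C%C = `|x|.
Proof. by rewrite /= expr0n addr0 sqrtr_sqr. Qed.

Lemma normcR_sub1 (x : R) : normc (x%:C%C - 1) = `|x - 1|.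
Proof. by rewrite -(rmorph1 (real_complex R)) -rmorphB normcR. Qed.

Lemma det_unitary n (U : 'M[C]_n) : unitary_mx U -> \det U != 0.
Proof.
move/(congr1 determinant); rewrite det_mulmx det1 => h; apply/eqP => h0.
by move/eqP: h; rewrite h0 mulr0 eq_sym oner_eq0.
Qed.

Lemma det_adjmx n (A : 'M[C]_n) : \det (adjmx A) = conjc (\det A).
Proof. by rewrite /adjmx det_map_mx det_tr. Qed.

(** Diagonalize [A^* A = V^* D V]. The columns of [A V^*] are orthogonal and
    their squared lengths [r j] are the entries of [D]; normalizing them gives
    the unitary factor, at distance [norm2 (sqrt D - 1)] from [A]. The bound
    follows from [`|sqrt r - 1| <= `|r - 1|]. *)
Lemma polar_invertible n (A : 'M[C]_n) : \det A != 0 ->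
  exists2 U : 'M[C]_n, unitary_mx U & norm2 (A - U) <= norm2 (adjmx A *m A - 1%:M).
Proof.
move=> iA; pose H := adjmx A *m A.
have hH : adjmx H = H by rewrite /H adjmxM adjmxK.
have [|V [d [uV HE]]] := @spectral_decomposition _ H; first by rewrite hH.
pose B := A *m adjmx V.
have BB : adjmx B *m B = diag_mx d.
  rewrite /B adjmxM adjmxK mulmxA -[V *m _ *m _]mulmxA -/H HE.
  exact: unitary_mx_conjK.
pose r j := \sum_i normc (B i j) ^+ 2.
have dr j : d 0 j = (r j)%:C%C.
  move/matrixP: BB => /(_ j j); rewrite !mxE eqxx mulr1n => <-.
  by rewrite rmorph_sum; apply: eq_bigr => i _; rewrite !mxE mul_conjc.
have iB : \det B != 0.
  by rewrite det_mulmx mulf_neq0// det_unitary//; exact: unitary_mx_adj.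
have r0 j : 0 < r j.
  rewrite lt_neqAle sumr_ge0 ?andbT => [|i _]; last exact: sqr_ge0.
  apply/eqP => rj.
  have : \det (diag_mx d) != 0.
    by rewrite -BB det_mulmx mulf_neq0// det_adjmx conjc_eq0.
  by rewrite det_diag (bigD1 j)//= dr -rj mul0r eqxx.
pose e : 'rV[C]_n := \row_j ((Num.sqrt (r j))^-1)%:C%C.
pose f : 'rV[C]_n := \row_j (Num.sqrt (r j))%:C%C.
have sr0 j : Num.sqrt (r j) != 0 by rewrite gt_eqF// sqrtr_gt0.
have ef : diag_mx e *m diag_mx f = 1%:M.
  by rewrite mulmx_diag; apply/matrixP => i j; rewrite !mxE -rmorphM mulVf.
have ae : adjmx (diag_mx e) = diag_mx e.
  by rewrite adjmx_diag; congr diag_mx; apply/rowP => j; rewrite !mxE conjc_real.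
pose U := B *m diag_mx e.
have uU : unitary_mx U.
  rewrite /unitary_mx /U adjmxM mulmxA -[_ *m _ *m B]mulmxA BB ae.
  rewrite !mulmx_diag; apply/matrixP => i j; rewrite !mxE dr -!rmorphM.
  by rewrite mulrAC -invfM -expr2 sqr_sqrtr ?ltW// mulVf ?lt0r_neq0.
exists (U *m V); first exact: unitary_mxM.
have -> : A - U *m V = U *m (diag_mx f - 1%:M) *m V.
  rewrite mulmxBr mulmxBl mulmx1 /U -[_ *m diag_mx f]mulmxA ef mulmx1.
  by rewrite /B -[A *m _ *m V]mulmxA uV mulmx1.
apply: le_trans (norm2_unitary _ uU uV) _.
apply: (@le_trans _ _ (norm2 (diag_mx d - 1%:M))).
  rewrite -diag_const_mx -!raddfB !norm2_diag ler_wsqrtr// ler_wpM2r ?invr_ge0//.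
  apply: ler_sum => j _; rewrite !mxE dr.
  rewrite !normcR_sub1 ler_sqr ?nnegrE//.
  rewrite -[in leRHS](sqr_sqrtr (ltW (r0 j))) subr_sqr_1 normrM.
  by rewrite ler_peMr// ger0_norm ?lerDr ?addr_ge0 ?sqrtr_ge0.
rewrite -(unitary_mx_conjK (diag_mx d) uV) -HE.
have -> : V *m H *m adjmx V - 1%:M = V *m (H - 1%:M) *m adjmx V.
  by rewrite mulmxBr mulmxBl mulmx1 (unitary_mxC uV).
by apply: norm2_unitary => //; exact: unitary_mx_adj.
Qed.

(** The characteristic polynomial has finitely many roots, so infinitely many
    small scalars are available. *)
Lemma invertible_perturbation n (A : 'M[C]_n) (e : R) : 0 < e ->
  exists2 t : R, 0 < t < e & \det (A + t%:C%C%:M) != 0.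
Proof.
move=> e0; pose p := char_poly (- A).
have p0 : p != 0 by rewrite monic_neq0// char_poly_monic.
(* the [size p] first candidates cannot all be roots of [p] *)
pose t (i : nat) : R := e / i.+2%:R.
have t_inj : injective t.
  move=> i j /(mulfI (lt0r_neq0 e0)) /invr_inj /eqP.
  by rewrite eqr_nat => /eqP [].
have [/allP h|/allPn[i _ hi]] :=
  boolP (all (fun i => root p (t i)%:C%C) (iota 0 (size p))).
  suff : (size [seq (t i)%:C%C | i <- iota 0 (size p)] < size p)%N.
    by rewrite size_map size_iota ltnn.
  apply: max_poly_roots => //.
    by apply/allP => _ /mapP[i /h ? ->].
  by rewrite map_inj_uniq ?iota_uniq// => i j /complexI; exact: t_inj.
exists (t i).
  by rewrite divr_gt0// ltr_pdivrMr// ltr_pMr// ltr1n.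
apply: contra hi => /eqP h; rewrite /root /p /char_poly -[_.[_]]/(horner_eval _ _).
rewrite -det_map_mx /= -[X in _ == X]h; apply/eqP; congr (\det _).
apply/matrixP => i0 j0; rewrite !mxE /horner_eval /= .
by rewrite !hornerE hornerMn hornerX addrC mulrb opprK.
Qed.

(** The error is measured by normalized 2-norms only, so the estimate is
    uniform in the dimension. A singular [A] is first moved to the invertible matrix
    [A + t] for a tiny scalar [t]. *)
Lemma polar_approx n (A : 'M[C]_n) (e : R) : 0 < e ->
  exists2 U : 'M[C]_n, unitary_mx U
    & norm2 (A - U) <= norm2 (adjmx A *m A - 1%:M) + e.
Proof.
(* [t * M] bounds the total effect of adding the scalar [t], as [t < 1] *)
move=> e0; pose M := 2 * norm2 A + 2; have M0 : 0 < M.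
  by rewrite /M; have := norm2_ge0 A; lra.
have t0 : 0 < Num.min 1 (e / M).
  by rewrite lt_min ltr01; exact: divr_gt0.
have [t /andP[tgt0 ltt] iB] := invertible_perturbation A t0.
move: ltt; rewrite lt_min ltr_pdivlMr// => /andP[t1 tM].
have t_ge0 := ltW tgt0.
have [U uU AU] := polar_invertible iB; exists U => //.
pose T : 'M[C]_n := t%:C%C%:M.
have nT : norm2 T <= t.
  by rewrite /T -scalemx1 norm2Z normcR ger0_norm// ler_piMr// norm2_1.
rewrite -[A - U](addrK T) [A - U + T]addrAC.
apply: le_trans (norm2D _ _) _; rewrite norm2N.
apply: (@le_trans _ _ (norm2 (adjmx A *m A - 1%:M) + t * (2 * norm2 A + 1) + t)); last first.
  rewrite -addrA lerD2l -[X in _ + X](mulr1 t) -mulrDr -addrA; exact: ltW.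
rewrite lerD//; apply: le_trans AU _.
have aT : adjmx T = T.
  rewrite /T -scalemx1 adjmxZ adjmx1; congr (_ *: _); exact: conjc_real.
have -> : adjmx (A + T) *m (A + T) - 1%:M =
    (adjmx A *m A - 1%:M) + t%:C%C *: (A + adjmx A + T).
  have TX (X : 'M[C]_n) : T *m X = t%:C%C *: X by exact: mul_scalar_mx.
  have XT (X : 'M[C]_n) : X *m T = t%:C%C *: X by exact: mul_mx_scalar.
  rewrite adjmxD aT mulmxDl !mulmxDr !TX XT !scalerDr [RHS]addrAC; congr (_ - _).
  by rewrite -!addrA; congr (_ + _); rewrite addrCA.
apply: le_trans (norm2D _ _) _; rewrite lerD2l norm2Z normcR ger0_norm//.
rewrite ler_wpM2l//; apply: le_trans (norm2D _ _) _.
rewrite lerD//; last by apply: le_trans nT _; exact: ltW.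
by apply: le_trans (norm2D _ _) _; rewrite norm2_adj; lra.
Qed.
End Spectral.

(** * Limits along the ultrafilter *)

Section Ultralimits.
Variables (R : realType) (omega : free_ultrafilter nat).
Local Notation C := R[i].

(** Freeness gives, for each [m], a set of the ultrafilter that avoids [m];
    intersecting finitely many of them leaves only large indices. *)
Lemma free_ultrafilter_large m : \forall k \near (omega : set_system nat), (m <= k)%N.
Proof.
elim: m => [|m IHm]; first exact: nearW.
have [A [oA Am]] : exists A, (omega : set_system nat) A /\ ~ A m.
  apply: contrapT => h; have : (\bigcap_(A in (omega : set_system nat)) A) m.
    by move=> A oA; apply: contrapT => Am; apply: h; exists A.
  by rewrite (ultrafilter_free omega).
near=> k; rewrite ltn_neqAle; apply/andP; split; last by near: k.
by apply/eqP => mk; apply: Am; rewrite mk; near: k.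
Unshelve. all: by end_near. Qed.

Lemma free_ultrafilter_cvg (f : nat -> R) (l : R) :
  f @ \oo --> l -> f k @[k --> (omega : set_system nat)] --> l.
Proof.
move=> fl A /fl[m _ mA]; apply: filterS (free_ultrafilter_large m) => k mk.
exact: mA.
Qed.

Lemma dominated_cvg0 (f g : nat -> R) : (forall k, 0 <= f k <= g k) ->
  g k @[k --> (omega : set_system nat)] --> (0 : R) ->
  f k @[k --> (omega : set_system nat)] --> (0 : R).
Proof.
move=> fg g0; apply: (@squeeze_cvgr _ _ _ _ (fun=> 0) g) => //; last exact: cvg_cst.
exact: nearW.
Qed.

Lemma cvg0D (f g : nat -> R) :
  f k @[k --> (omega : set_system nat)] --> (0 : R) ->
  g k @[k --> (omega : set_system nat)] --> (0 : R) ->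
  f k + g k @[k --> (omega : set_system nat)] --> (0 : R).
Proof. by move=> f0 g0; rewrite -[0 in X in _ --> X](addr0 0); exact: cvgD. Qed.

Lemma cvg0Z (c : R) (f : nat -> R) :
  f k @[k --> (omega : set_system nat)] --> (0 : R) ->
  c * f k @[k --> (omega : set_system nat)] --> (0 : R).
Proof. by move=> f0; rewrite -(mulr0 c); exact: cvgMr. Qed.

Lemma cvg0_sum (I : Type) (r : seq I) (P : pred I) (f : I -> nat -> R) :
  (forall i, f i k @[k --> (omega : set_system nat)] --> (0 : R)) ->
  \sum_(i <- r | P i) f i k @[k --> (omega : set_system nat)] --> (0 : R).
Proof.
move=> f0; elim: r => [|i r IHr].
  by under eq_fun do rewrite big_nil; exact: cvg_cst.
under eq_fun do rewrite big_cons.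
by case: (P i) => //; exact: cvg0D.
Qed.

(** Convergence along [omega] is expressed through the real sequence of moduli,
    so that estimates of norms apply to it directly. *)
Definition ultra_lim (f : nat -> C) (l : C) :=
  normc (f k - l) @[k --> (omega : set_system nat)] --> (0 : R).

Lemma ultra_lim_cst c : ultra_lim (fun=> c) c.
Proof. by rewrite /ultra_lim subrr normc0; exact: cvg_cst. Qed.

Lemma ultra_limD f g a b :
  ultra_lim f a -> ultra_lim g b -> ultra_lim (fun k => f k + g k) (a + b).
Proof.
move=> fa gb; apply: (dominated_cvg0 _ (cvg0D fa gb)) => k.
by rewrite normc_ge0 opprD addrACA le_normcD.
Qed.

Lemma ultra_limZ c f a : ultra_lim f a -> ultra_lim (fun k => c * f k) (c * a).
Proof.
move=> fa; apply: (dominated_cvg0 _ (cvg0Z (normc c) fa)) => k.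
by rewrite normc_ge0 -mulrBr normcM /=.
Qed.

Lemma ultra_lim_sum (I : Type) (r : seq I) (f : I -> nat -> C) (a : I -> C) :
  (forall i, ultra_lim (f i) (a i)) ->
  ultra_lim (fun k => \sum_(i <- r) f i k) (\sum_(i <- r) a i).
Proof.
move=> fa; elim: r => [|i r IHr].
  by rewrite big_nil; under eq_fun do rewrite big_nil; exact: ultra_lim_cst.
by rewrite big_cons; under eq_fun do rewrite big_cons; exact: ultra_limD.
Qed.

Lemma ultra_lim_bound (f : nat -> C) (l : C) (e : R) :
  ultra_lim f l -> (forall k, e <= normc (f k - l)) -> e <= 0.
Proof.
move=> /cvgrPdist_lt fl h; rewrite leNgt; apply/negP => e0.
have [k] := @filter_ex _ (omega : set_system nat) _ _ (fl e e0).
by rewrite /= sub0r normrN ger0_norm ?normc_ge0// ltNge h.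
Qed.

Lemma ultra_lim_unique f a b : ultra_lim f a -> ultra_lim f b -> a = b.
Proof.
move=> fa fb; apply/eqP; rewrite -subr_eq0; apply/eqP/eq0_normc.
apply/le_anti; rewrite normc_ge0 andbT.
apply: (ultra_lim_bound (ultra_limD fa (ultra_limZ (-1) fb))) => k.
by rewrite !mulN1r subrr sub0r normcN.
Qed.

Lemma ultra_lim_ge0 f a : ultra_lim f a -> (forall k, 0 <= f k) -> 0 <= a.
Proof.
move=> fa f0; case: a fa => x y fa; rewrite lecE /=.
have normc_ge (z : C) : `|complex.Re z| <= normc z /\ `|complex.Im z| <= normc z.
  case: z => c d /=; rewrite -!sqrtr_sqr !ler_wsqrtr//.
    by rewrite lerDr sqr_ge0.
  by rewrite lerDl sqr_ge0.
apply/andP; split.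
  rewrite -normr_le0; apply: (ultra_lim_bound fa) => k; apply: le_trans (normc_ge _).2.
  by have := f0 k; case: (f k) => c d; rewrite lecE => /andP[/eqP /= -> _]; rewrite sub0r normrN.
rewrite leNgt; apply/negP => x0; suff : - x <= 0 by rewrite oppr_le0 leNgt x0.
apply: (ultra_lim_bound fa) => k; apply: le_trans (normc_ge _).1.
have := f0 k; case: (f k) => c d; rewrite lecE => /andP[_ /= c0].
by rewrite ger0_norm; lra.
Qed.

Lemma ultra_lim_normc_le f a (M : R) :
  ultra_lim f a -> (forall k, normc (f k) <= M) -> normc a <= M.
Proof.
move=> fa fM; rewrite -subr_le0; apply: (ultra_lim_bound fa) => k.
rewrite lerBlDr; apply: (le_trans _ (lerD (lexx _) (fM k))).
rewrite -(normcN (f k - a)) opprB -{1}(subrK (f k) a); exact: le_normcD.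
Qed.

Section Ultraproduct.
Variable n : nat -> nat.
Local Notation cl := (@uclass R n omega).

Lemma ultra_lim_utr (x : linfty R n) : ultra_lim (fun k => ntr (x k)) (utr (cl x)).
Proof.
have [l xl] := cvg_ntr_normc omega x.
by rewrite utr_uclass (cvg_lim _ (cvg_complex xl)).
Qed.

Lemma uclassX (x : linfty R n) m : cl x ^+ m = cl (x ^+ m).
Proof.
elim: m => [|m IHm]; first by rewrite !expr0 uclass1.
by rewrite !exprS IHm uclassM.
Qed.

Lemma linftyX (x : linfty R n) m k : (x ^+ m) k = x k ^+ m.
Proof. by elim: m => [//|m IHm]; rewrite !exprS -IHm. Qed.

Lemma ultra_lim_utrX (x : linfty R n) m :
  ultra_lim (fun k => ntr (x k ^+ m)) (utr (cl x ^+ m)).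
Proof.
rewrite uclassX; under eq_fun do rewrite -linftyX; exact: ultra_lim_utr.
Qed.

Lemma bounded_unitary (x : mxseq R n) : (forall k, unitary_mx (x k)) ->
  x \in @bounded_mxseq R n.
Proof.
by move=> ux; apply/asboolP; exists 1 => k; exact: opnorm_unitary.
Qed.

(** Any representative [x] of [u] satisfies [norm2 (x^* x - 1) --> 0], hence
    differs by a null sequence from a sequence of approximate unitary polar
    parts. *)
Lemma unitary_lift (u : uprod R n omega) : unitary u ->
  exists x : linfty R n, cl x = u /\ forall k, unitary_mx (x k).
Proof.
move=> [uu _]; pose x := urep u.
have x0 : linfty_star x * x - 1 \in null_mxseq omega.
  apply/uclass_eqP; rewrite uclassM uclass_star uclass1 /x uclassK; exact: uu.
have lift k : exists V : 'M[C]_(n k), unitary_mx V /\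
    norm2 (x k - V) <= norm2 (adjmx (x k) *m x k - 1%:M) + k.+1%:R^-1.
  have [|V uV HV] := @polar_approx R _ (x k) k.+1%:R^-1; last by exists V.
  by rewrite invr_gt0.
pose U : mxseq R n := fun k => sval (cid (lift k)).
have uU k : unitary_mx (U k) by have [] := svalP (cid (lift k)).
have xU k : norm2 (x k - U k) <= norm2 (adjmx (x k) *m x k - 1%:M) + k.+1%:R^-1.
  by have [] := svalP (cid (lift k)).
exists (Linfty (bounded_unitary uU)); split; last exact: uU.
apply: etrans (uclassK u); apply/esym/uclass_eqP.
apply: (@null_squeeze _ _ _ (x - Linfty (bounded_unitary uU)) _ xU).
move/null_mxseqP: x0 => x0.
apply: (cvg0D x0 (free_ultrafilter_cvg _)); exact: cvg_harmonic.
Qed.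
End Ultraproduct.
End Ultralimits.

(** * Moebius inversion and permutations of given cycle type *)

Section DivisorDifferences.
Variable K : comPzRingType.

(** The alternating sum defining [c_i], with an arbitrary [f m] in place of
    [Tr (u ^ m)]. *)
Definition divisor_difference (f : nat -> K) (i : nat) : K :=
  let t := size (primes i) in
  let a (j : 'I_t) := nth 0%N (primes i) j in
  let r (j : 'I_t) := logn (a j) i in
  \sum_(e : {ffun 'I_t -> bool})
     (-1) ^+ (\sum_j e j) * f (\prod_j a j ^ (r j - e j))%N.

Section Shift.
Local Open Scope nat_scope.
Variables (i : nat) (e : 'I_(size (primes i)) -> nat).
Local Notation a j := (nth 0%N (primes i) j).

Lemma prime_nth_primes (j : 'I_(size (primes i))) : prime (a j).
Proof. by have := mem_nth 0%N (ltn_ord j); rewrite mem_primes => /andP[]. Qed.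

Lemma prod_primes_gt0 (r : seq 'I_(size (primes i))) : 0 < \prod_(l <- r) a l ^ e l.
Proof.
by rewrite prodn_cond_gt0// => l _; rewrite expn_gt0 prime_gt0 ?prime_nth_primes.
Qed.

Lemma logn_prod_primes (j : 'I_(size (primes i))) :
  logn (a j) (\prod_(l < size (primes i)) a l ^ e l) = e j.
Proof.
have h (r : seq 'I_(size (primes i))) : logn (a j) (\prod_(l <- r) a l ^ e l) =
    (\sum_(l <- r) (j == l) * e l)%N.
  elim: r => [|l r IHr]; first by rewrite !big_nil logn1.
  rewrite !big_cons lognM ?IHr ?prod_primes_gt0//; last first.
    by rewrite expn_gt0 prime_gt0 ?prime_nth_primes.
  rewrite lognX logn_prime ?prime_nth_primes// mulnC.
  by rewrite nth_uniq ?primes_uniq// eq_sym.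
rewrite h (bigD1 j)//= eqxx mul1n big1 ?addn0// => l lj.
by rewrite eq_sym (negPf lj).
Qed.

Lemma dvdn_prod_primes d : (0 < i)%N -> (d %| i)%N ->
  (d %| \prod_(l < size (primes i)) a l ^ e l)%N = [forall j : 'I_(size (primes i)), logn (a j) d <= e j]%N.
Proof.
move=> i0 di; have d0 := dvdn_gt0 i0 di.
have P0 : (0 < \prod_(l < size (primes i)) a l ^ e l)%N. by exact: prod_primes_gt0.
apply/idP/forallP => [h j|h].
  by rewrite -logn_prod_primes; exact: dvdn_leq_log.
apply/dvdn_partP => // p; rewrite /= mem_primes => /and3P[pp _ pd].
rewrite p_part pfactor_dvdn//.
have pi : p \in primes i by rewrite mem_primes pp i0 (dvdn_trans pd di).
have jp : (index p (primes i) < size (primes i))%N by rewrite index_mem.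
have := h (Ordinal jp); rewrite -[X in (_ <= X)%N](logn_prod_primes (Ordinal jp)) /=.
by rewrite nth_index.
Qed.
End Shift.

Lemma natr_forall (I : finType) (b : pred I) :
  [forall j, b j]%:R = \prod_j (b j)%:R :> K.
Proof.
case: (boolP [forall j, b j]) => [/forallP h|].
  by rewrite big1// => j _; rewrite h.
rewrite negb_forall => /existsP[j /negPf bj].
by rewrite (bigD1 j)//= bj mul0r.
Qed.

Lemma prod_primes_dvd i (e : 'I_(size (primes i)) -> nat) : (0 < i)%N ->
  (\prod_(j < size (primes i)) nth 0 (primes i) j ^ (logn (nth 0 (primes i) j) i - e j) %| i)%N.
Proof.
move=> i0; rewrite [X in (_ %| X)%N]prod_prime_decomp// prime_decompE big_map (big_nth 0%N).
rewrite big_mkord; elim/big_rec2: _ => // j m p _ mp.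
by rewrite dvdn_mul// dvdn_exp2l// leq_subr.
Qed.

(** If [d] divides [i], the divisibility conditions at the primes of [i] are
    independent and the sum factors over these primes. With [v] and [r] the
    valuations of [d] and [i], the factor at one prime is
    [(v <= r) - (v <= r - 1)], which is [v == r]. *)
Lemma divisor_difference_dvdn d i : (0 < d)%N -> (0 < i)%N ->
  divisor_difference (fun m => (d %| m)%:R) i = (d == i)%:R.
Proof.
move=> d0 i0; rewrite /divisor_difference.
have [di|ndi] := boolP (d %| i)%N; last first.
  rewrite big1 => [|e _].
    by case: eqP ndi => // ->; rewrite dvdnn.
  set m := (\prod_j _)%N; have -> : (d %| m)%N = false; last by rewrite mulr0.
  apply: contraNF ndi => /dvdn_trans; apply; exact: prod_primes_dvd.
set t := size _; pose a (j : 'I_t) := nth 0%N (primes i) j.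
pose F (j : 'I_t) (b : bool) : K :=
  (-1) ^+ b * (logn (a j) d <= logn (a j) i - b)%N%:R.
transitivity (\sum_(e : {ffun 'I_t -> bool}) \prod_j F j (e j)).
  apply: eq_bigr => e _; rewrite dvdn_prod_primes// natr_forall.
  by rewrite -prodrXr -big_split.
rewrite -bigA_distr_bigA.
transitivity (\prod_j ((logn (a j) d == logn (a j) i)%:R : K)).
  apply: eq_bigr => j _; rewrite big_bool /F /= expr1 expr0 mul1r mulN1r subn0.
  have dj : (logn (a j) d <= logn (a j) i)%N by exact: dvdn_leq_log.
  have aj : (0 < logn (a j) i)%N by rewrite logn_gt0 mem_nth.
  rewrite dj; case: ltngtP dj => // [lt|->] _.
    by rewrite -ltnS subn1 prednK// lt addNr.
  by rewrite leqNgt subn1 prednK// leqnn oppr0 add0r.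
rewrite -natr_forall; congr (nat_of_bool _)%:R; apply/forallP/eqP => [h|-> //].
apply/eqP; rewrite eqn_dvd di; apply/dvdn_partP => // p pi.
rewrite p_part; move: pi; rewrite /= => pi.
have jp : (index p (primes i) < t)%N by rewrite index_mem.
have := h (Ordinal jp); rewrite /a /= nth_index// => /eqP <-.
exact: pfactor_dvdnn.
Qed.

Lemma divisor_difference_eq (f g : nat -> K) i : (0 < i)%N ->
  (forall m, (0 < m <= i)%N -> f m = g m) ->
  divisor_difference f i = divisor_difference g i.
Proof.
move=> i0 fg; apply: eq_bigr => e _; congr (_ * _); apply: fg.
by rewrite prod_primes_gt0 dvdn_leq// prod_primes_dvd.
Qed.

Lemma divisor_difference_sum (I : Type) (r : seq I) (c : I -> K) (f : I -> nat -> K) i :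
  divisor_difference (fun m => \sum_(l <- r) c l * f l m) i =
  \sum_(l <- r) c l * divisor_difference (f l) i.
Proof.
under [RHS]eq_bigr do rewrite mulr_sumr.
rewrite [RHS]exchange_big; apply: eq_bigr => e _.
by rewrite mulr_sumr; apply: eq_bigr => l _; rewrite mulrCA.
Qed.

(** The functions [m |-> (d %| m)] form a triangular family, so the
    coefficients can be solved for one after the other. *)
Lemma divisor_expansion (f : nat -> K) M : exists g : nat -> K,
  forall m, (0 < m <= M)%N -> f m = \sum_(1 <= d < M.+1) g d * (d %| m)%:R.
Proof.
elim: M => [|M [g gP]]; first by exists (fun=> 0) => -[|m].
pose x := f M.+1 - \sum_(1 <= d < M.+1) g d * (d %| M.+1)%:R.
exists (fun d => if d == M.+1 then x else g d) => m /andP[m0 mM].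
rewrite big_nat_recr//= eqxx (eq_big_nat _ _ (F2 := fun d => g d * (d %| m)%:R)).
  case: (ltngtP m M.+1) mM => // [mM|->] _; last by rewrite dvdnn mulr1 /x addrC subrK.
  by rewrite gtnNdvd// mulr0 addr0; apply: gP; rewrite m0.
by move=> d /andP[_ dM]; rewrite ltn_eqF.
Qed.

(** Moebius inversion: in the expansion of [f] along divisibility functions,
    [divisor_difference] reads off the coefficients. *)
Lemma divisor_difference_inversion (f : nat -> K) m M : (0 < m <= M)%N ->
  f m = \sum_(1 <= d < M.+1) divisor_difference f d * (d %| m)%:R.
Proof.
move=> mM; have [g gP] := divisor_expansion f M; rewrite (gP m mM).
apply: eq_big_nat => d /andP[d0 dM]; congr (_ * _).
rewrite (divisor_difference_eq d0 (g := fun m => \sum_(1 <= d < M.+1) g d * (d %| m)%:R)).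
  rewrite divisor_difference_sum.
  rewrite (eq_big_nat _ _ (F2 := fun l => g l * (l == d)%:R)).
    rewrite (bigD1_seq d) ?mem_index_iota ?d0 ?iota_uniq//= eqxx mulr1.
    by rewrite big1 ?addr0// => l /negPf->; rewrite mulr0.
  by move=> l /andP[l0 _]; rewrite divisor_difference_dvdn.
by move=> l /andP[l0 ld]; apply: gP; rewrite l0 (leq_trans ld).
Qed.
End DivisorDifferences.

Section CycleTypes.
Lemma perm_period (T : finType) (s : {perm T}) x :
  exists2 d, (0 < d)%N & forall m, ((s ^+ m)%g x == x) = (d %| m)%N.
Proof.
have ex : exists d, (0 < d)%N && ((s ^+ d)%g x == x).
  by exists #[s]%g; rewrite order_gt0 expg_order perm1 eqxx.
case: (ex_minnP ex) => d /andP[d0 /eqP dx] dmin; exists d => // m.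
have dq q : ((s ^+ (q * d))%g x) = x.
  by elim: q => [|q IHq]; rewrite ?mul0n ?expg0 ?perm1// mulSn expgD permM dx.
rewrite {1}(divn_eq m d) expgD permM dq; apply/eqP/idP => [mx|/eqP->].
  apply: contraT; rewrite /dvdn -lt0n => r0.
  have := dmin (m %% d)%N; rewrite r0 mx eqxx => /(_ isT).
  by rewrite leqNgt ltn_pmod.
by rewrite expg0 perm1.
Qed.

Definition fixed_points (T : finType) (s : {perm T}) : nat := #|[pred x | s x == x]|.

Lemma fixed_points_sum (T : finType) (s : {perm T}) :
  fixed_points s = (\sum_x (s x == x))%N.
Proof.
rewrite /fixed_points -sum1_card big_mkcond; apply: eq_bigr => x _.
by rewrite inE; case: eqP.
Qed.

Section Rotation.
Variables (I : finType) (l : I -> nat).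
Local Notation T := {i : I & 'I_(l i)}.

Definition rotation (u : T) : T := Tagged (fun i => 'I_(l i)) (ordS (tagged u)).

Lemma rotation_inj : injective rotation.
Proof.
apply: (can_inj (g := fun u : T => Tagged (fun i => 'I_(l i)) (ord_pred (tagged u)))).
by move=> [i x]; rewrite /rotation /= ordSK.
Qed.

Lemma iter_ordS n m (x : 'I_n) : iter m (@ordS n) x = ((x + m) %% n)%N :> nat.
Proof.
elim: m => [|m IHm] /=; first by rewrite addn0 modn_small.
by rewrite IHm -[(_ %% n).+1]addn1 modnDml addn1 addnS.
Qed.

Lemma iter_rotation_fixed m (u : T) :
  (iter m rotation u == u) = (l (tag u) %| m)%N.
Proof.
have -> : iter m rotation u = Tagged (fun i => 'I_(l i)) (iter m (@ordS _) (tagged u)).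
  by elim: m => [|m IHm]; [case: u | rewrite /= IHm].
case: u => i x /=; rewrite eq_Tagged /= -val_eqE /= iter_ordS.
by rewrite -{2}(modn_small (ltn_ord x)) -[X in _ == X %[mod _]]addn0 eqn_modDl mod0n.
Qed.

(** Rotate each cycle by one step: its points are fixed by the [m]-th power
    exactly when the length divides [m]. Lengths equal to [0] are harmless, as
    they contribute no points. *)
Lemma perm_of_cycle_lengths n : (\sum_i l i = n)%N ->
  exists s : 'S_n, forall m, fixed_points (s ^+ m)%g = (\sum_i l i * (l i %| m))%N.
Proof.
have cardT : #|{: T}| = (\sum_i l i)%N.
  by rewrite card_tagged sumnE big_map big_enum /=; apply: eq_bigr => i _; rewrite card_ord.
move=> <-; case: _ / cardT.
pose f (j : 'I_#|{: T}|) := enum_rank (rotation (enum_val j)).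
have f_inj : injective f.
  by move=> j k /enum_rank_inj/rotation_inj/enum_val_inj.
exists (perm f_inj) => m.
have itf j : (perm f_inj ^+ m)%g j = enum_rank (iter m rotation (enum_val j)).
  rewrite permX; elim: m => [|m IHm] /=; first by rewrite enum_valK.
  by rewrite IHm permE /f enum_rankK.
rewrite fixed_points_sum.
transitivity (\sum_(u : T) (l (tag u) %| m))%N.
  rewrite [RHS](reindex (@enum_val _ {: T})) /=; last first.
    by apply: onW_bij; exact: enum_val_bij.
  apply: eq_bigr => j _; rewrite itf.
  rewrite -iter_rotation_fixed -[X in _ == X]enum_valK.
  by rewrite (inj_eq enum_rank_inj).
rewrite -(sig_big_dep xpredT (fun _ => xpredT) (fun i (_ : 'I_(l i)) => nat_of_bool (l i %| m)%N)) /=.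
by apply: eq_bigr => i _; rewrite sum_nat_const card_ord.
Qed.
End Rotation.

Section PermutationMatrices.
Variable R : realType.
Local Notation C := R[i].

Lemma perm_mxX n (s : 'S_n) m : perm_mx s ^+ m = perm_mx (s ^+ m)%g :> 'M[C]_n.
Proof.
elim: m => [|m IHm]; first by rewrite expr0 expg0 perm_mx1.
by rewrite exprS expgS perm_mxM -IHm.
Qed.

Lemma mxtrace_perm n (s : 'S_n) : \tr (perm_mx s : 'M[C]_n) = (fixed_points s)%:R.
Proof.
rewrite fixed_points_sum natr_sum; apply: eq_bigr => j _.
by rewrite !mxE.
Qed.

Lemma ntr_permX n (s : 'S_n) m :
  ntr (perm_mx s ^+ m : 'M[C]_n) = (fixed_points (s ^+ m)%g)%:R / n%:R.
Proof. by rewrite perm_mxX /ntr mxtrace_perm. Qed.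

(** Only the points of period [i] survive in the alternating sum, each of
    them contributing [1 / n]. *)
Lemma divisor_difference_perm n (s : 'S_n) i : (0 < i)%N ->
  0 <= divisor_difference (fun m => ntr (perm_mx s ^+ m : 'M[C]_n)) i.
Proof.
move=> i0; have /choice[per perP] : forall x, exists d, (0 < d)%N /\
    forall m, ((s ^+ m)%g x == x) = (d %| m)%N.
  by move=> x; have [d] := perm_period s x; exists d.
have -> : (fun m => ntr (perm_mx s ^+ m : 'M[C]_n)) =
    (fun m => \sum_x n%:R^-1 * (per x %| m)%:R).
  apply/funext => m; rewrite ntr_permX fixed_points_sum natr_sum mulr_suml.
  by apply: eq_bigr => x _; rewrite (perP x).2 mulrC.
rewrite divisor_difference_sum sumr_ge0// => x _.
by rewrite divisor_difference_dvdn ?(perP x).1// mulr_ge0 ?invr_ge0 ?ler0n.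
Qed.

(** Take [q d] cycles of length [d], the largest number that covers a
    proportion at most [c d] of the points, and put the remaining points on one
    single cycle. Rounding loses at most [d] points for each length [d], and
    the last cycle is seen by the [m]-th power only if its length divides [m],
    hence is at most [m]. *)
Lemma perm_of_cycle_proportions (c : nat -> R) n : (0 < n)%N ->
  (forall d, 0 <= c d) -> \sum_(1 <= d < n.+1) c d <= 1 ->
  exists s : 'S_n, forall m, (0 < m <= n)%N ->
    `|(fixed_points (s ^+ m)%g)%:R / n%:R - \sum_(1 <= d < m.+1) c d * (d %| m)%:R|
      <= (m%:R + \sum_(1 <= d < m.+1) d%:R) * n%:R^-1.
Proof.
move=> n0 c0 c1; pose q d := Num.truncn (c d * n%:R / d%:R).
have nR : (0 : R) < n%:R by rewrite ltr0n.
have qle d : (0 < d)%N -> (q d * d)%:R <= c d * n%:R.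
  move=> d0; rewrite natrM -ler_pdivlMr ?ltr0n// truncn_le.
  by rewrite divr_ge0 ?mulr_ge0.
have qge d : (0 < d)%N -> c d * n%:R - (q d * d)%:R <= d%:R.
  move=> d0; have dR : (0 : R) < d%:R by rewrite ltr0n.
  rewrite lerBlDr -natrD -mulSn natrM -ler_pdivrMr//; exact/ltW/truncnS_gt.
pose Q := (\sum_(1 <= d < n.+1) q d * d)%N.
have Qn : (Q <= n)%N.
  rewrite -(ler_nat R) natr_sum.
  apply: (@le_trans _ _ (\sum_(1 <= d < n.+1) c d * n%:R)).
    by rewrite big_nat [leRHS]big_nat; apply: ler_sum => d /andP[d0 _]; exact: qle.
  by rewrite -mulr_suml ler_piMl.
pose ls := (n - Q)%N :: flatten [seq nseq (q d) d | d <- index_iota 1 n.+1].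
have lsE (F : nat -> nat) : (\sum_(l <- ls) F l = F (n - Q) + \sum_(1 <= d < n.+1) q d * F d)%N.
  rewrite big_cons big_flatten big_map; congr (_ + _)%N; apply: eq_bigr => d _.
  by rewrite big_nseq iter_addn_0 mulnC.
have [|s sP] := @perm_of_cycle_lengths _ (fun i : 'I_(size ls) => nth 0%N ls i) n.
  by rewrite -(big_mkord xpredT (fun i => nth 0%N ls i)) -(big_nth 0%N xpredT id) lsE subnK.
exists s => m /andP[m0 mn].
have -> : fixed_points (s ^+ m)%g =
    ((n - Q) * ((n - Q) %| m) + \sum_(1 <= d < m.+1) q d * d * (d %| m))%N.
  rewrite sP -(big_mkord xpredT (fun i => nth 0%N ls i * (nth 0%N ls i %| m))%N).
  rewrite -(big_nth 0%N xpredT (fun l => l * (l %| m))%N) lsE; congr (_ + _)%N.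
  rewrite (@big_cat_nat _ _ _ m.+1)//= [X in (_ + X)%N]big_nat [X in (_ + X)%N]big1 ?addn0.
    by apply: eq_bigr => d _; rewrite mulnA.
  by move=> d /andP[md _]; rewrite gtnNdvd// !muln0.
have -> : (((n - Q) * ((n - Q) %| m) + \sum_(1 <= d < m.+1) q d * d * (d %| m))%N)%:R / n%:R
    - \sum_(1 <= d < m.+1) c d * (d %| m)%:R =
    (((n - Q) * ((n - Q) %| m))%N%:R
      + \sum_(1 <= d < m.+1) ((q d * d)%:R - c d * n%:R) * (d %| m)%:R) * n%:R^-1 :> R.
  rewrite natrD natr_sum !mulrDl -addrA; congr (_ + _).
  rewrite !mulr_suml -sumrB; apply: eq_bigr => d _.
  by rewrite natrM mulrBl mulrBl [c d * _ * _]mulrAC mulfK// lt0r_neq0.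
rewrite normrM [`|n%:R^-1|]ger0_norm ?invr_ge0 ?ler0n// ler_wpM2r ?invr_ge0 ?ler0n//.
apply: le_trans (ler_normD _ _) _; rewrite lerD//.
  rewrite ger0_norm ?ler0n// ler_nat.
  by case: (boolP ((n - Q) %| m)%N) => [/(dvdn_leq m0)|_]; rewrite ?muln1 ?muln0.
apply: le_trans (ler_norm_sum _ _ _) _.
rewrite big_nat [leRHS]big_nat; apply: ler_sum => d /andP[d0 _].
rewrite normrM distrC [`|(_ %| _)%:R|]ger0_norm ?ler0n//.
rewrite ger0_norm ?subr_ge0 ?qle//.
apply: le_trans (qge d d0); rewrite ler_piMr ?subr_ge0 ?qle//.
by case: (d %| m)%N; rewrite ?ler01 ?lexx.
Qed.

End PermutationMatrices.
End CycleTypes.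

(** * Pairing points of the circle with equal moments *)

Section RandomWalk.
Variable R : realType.
Local Notation C := R[i].

(** Trigonometric polynomials: on the unit circle [z^-1] is the conjugate of
    [z], so multiplying by a power of [z] clears the negative frequencies. *)
Definition trig_poly (F : C -> R) := exists d (P : {poly C}),
  forall z, normc z = 1 -> (F z)%:C%C * z ^+ d = P.[z].

Lemma trig_polyM (F G : C -> R) :
  trig_poly F -> trig_poly G -> trig_poly (fun z => F z * G z).
Proof.
move=> [d [P FP]] [e [Q GQ]]; exists (d + e)%N, (P * Q) => z z1.
by rewrite hornerM -FP// -GQ// rmorphM exprD mulrACA.
Qed.

Lemma sqr_normc (z : C) : normc z ^+ 2 = complex.Re z ^+ 2 + complex.Im z ^+ 2.
Proof. by case: z => a b; rewrite /= sqr_sqrtr// addr_ge0 ?sqr_ge0. Qed.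

(** A random step in one of the four directions [1], [-1], [i], [-i], with
    [step_weight k z] the probability of direction [k]. For [z] on the circle
    the mean direction is [z / 2], so twice a step has mean [z]. *)
Definition step (k : 'I_4) : C := nth 0 [:: 1; -1; 'i%C; -'i%C] k.

Definition step_weight (k : 'I_4) (z : C) : R :=
  (1 + complex.Re (z * conjc (step k))) / 4.

Lemma trig_poly_step k : trig_poly (step_weight k).
Proof.
exists 1%N, ((8 : C)^-1 *: (2 *: 'X + (conjc (step k)) *: 'X^2 + (step k)%:P)) => z z1.
have zz : conjc z * z = 1 by rewrite mul_conjc z1 expr1n.
set w := z * conjc (step k).
have we : z * w + z * conjc w = conjc (step k) * z ^+ 2 + step k.
  have -> : conjc w = conjc z * step k.
    by rewrite [LHS]rmorphM; congr (_ * _); exact: conjcK.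
  by rewrite /w [z * (conjc z * _)]mulrA [z * conjc z]mulrC zz; ring.
have -> : (step_weight k z)%:C%C = (1 + (w + conjc w) / 2) / 4.
  by rewrite -ReJ_add /step_weight -/w rmorphM rmorphD rmorph1 fmorphV rmorph_nat.
by rewrite hornerZ !hornerD !hornerZ hornerX hornerXn hornerC expr1 -addrA -we; field.
Qed.

Lemma step_weight_ge0 k z : normc z = 1 -> 0 <= step_weight k z.
Proof.
move=> z1; have : complex.Re z ^+ 2 + complex.Im z ^+ 2 = 1.
  by rewrite -sqr_normc z1 expr1n.
case: z {z1} => a b /= ab; rewrite divr_ge0//.
case: k => -[|[|[|[|//]]]] k; rewrite /step /=; nra.
Qed.

Lemma sum_step_weight z : \sum_k step_weight k z = 1.
Proof.
rewrite !big_ord_recl big_ord0 /step_weight /step /=.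
by case: z => a b /=; lra.
Qed.

(** The step [2 * step k] has mean [z] and variance [3], so the cross term
    with [y] vanishes. *)
Lemma step_variance y z : normc z = 1 ->
  \sum_k step_weight k z * normc (y + (z - 2 * step k)) ^+ 2 = normc y ^+ 2 + 3.
Proof.
move=> z1; have : complex.Re z ^+ 2 + complex.Im z ^+ 2 = 1.
  by rewrite -sqr_normc z1 expr1n.
rewrite !big_ord_recl big_ord0 /step_weight /step /= !sqr_normc.
case: z {z1} => a b /= ab; case: y => u v /=.
have -> : (3 : R) = 4 - (a ^+ 2 + b ^+ 2) by rewrite ab; lra.
by field.
Qed.

(** [W t z] is the probability of the point [p t] under a law depending on [z],
    whose mean squared distance to [N * z] is [3 * N]. *)
Definition walk_kernel (N : nat) (T : finType) (p : T -> C) (W : T -> C -> R) :=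
  forall z, normc z = 1 ->
    [/\ forall t, 0 <= W t z, \sum_t W t z = 1
      & \sum_t W t z * normc (N%:R * z - p t) ^+ 2 = 3 * N%:R].

(** The position after [N] independent steps of mean [z]. Divided by [N] it
    spreads around [z] with variance [3 / N] only, while its law depends on [z]
    through trigonometric polynomials: this replaces the approximation of
    indicator functions of small arcs. *)
Lemma random_walk (N : nat) : exists (T : finType) (p : T -> C) (W : T -> C -> R),
  (forall t, trig_poly (W t)) /\ walk_kernel N p W.
Proof.
rewrite /walk_kernel; elim: N => [|N [T [p [W [Wp Wz]]]]].
  exists unit, (fun=> 0), (fun _ _ => 1); split=> [_|z z1].
    by exists 0%N, 1 => z _; rewrite mulr1 hornerC.
  rewrite !big_const card_unit /= !addr0; split=> //.
  by rewrite mul0r subrr normc0 expr0n !mulr0.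
exists (T * 'I_4)%type, (fun t => p t.1 + 2 * step t.2),
  (fun t z => W t.1 z * step_weight t.2 z); split=> [t|z z1].
  by apply: trig_polyM => //; exact: trig_poly_step.
have [W0 W1 W2] := Wz z z1; split=> [t||].
- by rewrite mulr_ge0// step_weight_ge0.
- rewrite -(pair_bigA _ (fun t k => W t z * step_weight k z)) /=.
  by under eq_bigr do rewrite -mulr_sumr sum_step_weight mulr1.
rewrite -(pair_bigA _ (fun t k => W t z * step_weight k z *
  normc (N.+1%:R * z - (p t + 2 * step k)) ^+ 2)) /=.
have h t : \sum_k W t z * step_weight k z *
    normc (N.+1%:R * z - (p t + 2 * step k)) ^+ 2 =
    W t z * normc (N%:R * z - p t) ^+ 2 + W t z * 3.
  under eq_bigr do rewrite -mulrA -natr1 mulrDl mul1r opprD addrACA.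
  by rewrite -mulr_sumr step_variance// mulrDr.
by rewrite (eq_bigr _ (fun t _ => h t)) big_split /= -mulr_suml W1 W2 -natr1; ring.
Qed.

Lemma average_attained (T : finType) (w f : T -> R) :
  (forall t, 0 <= w t) -> \sum_t w t = 1 -> exists t, f t <= \sum_t w t * f t.
Proof.
move=> w0 w1; set A := (X in exists t, _ <= X).
apply: contrapT => /forallNP h.
have lt_f t : A < f t by rewrite ltNge; apply/negP/h.
have : \sum_t w t * (f t - A) = 0.
  by under eq_bigr do rewrite mulrBr; rewrite sumrB -mulr_suml w1 mul1r subrr.
move/eqP; rewrite psumr_eq0 => [/allP w_eq0|t _]; last first.
  by rewrite mulr_ge0// subr_ge0 ltW.
suff : \sum_t w t = 0 by rewrite w1 => /eqP; rewrite oner_eq0.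
apply: big1 => t _; have := w_eq0 t (mem_index_enum _).
by rewrite mulf_eq0 subr_eq0 (gt_eqF (lt_f t)) orbF => /eqP.
Qed.

(** Derandomized rounding. Choosing each [s i] at random with law [w i], the
    expected cost is the first sum on the right, and the expected squared
    deviations of the counts add up to at most [1] for each [i]. Choosing the
    values one at a time, never above the current expectation, keeps the total
    below the expectation. *)
Lemma greedy_rounding (I : eqType) (T : finType) (w c : I -> T -> R) (tau : R)
    (tdef : T) (r : seq I) : uniq r -> 0 <= tau ->
  (forall i t, 0 <= w i t) -> (forall i, \sum_t w i t = 1) ->
  exists s : I -> T,
    \sum_(i <- r) c i (s i)
      + tau * \sum_t (\sum_(i <- r) ((s i == t)%:R - w i t)) ^+ 2
    <= \sum_(i <- r) \sum_t w i t * c i t + tau * (size r)%:R.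
Proof.
move=> + tau0 w0 w1; elim: r => [_|i r IHr /= /andP[ir /IHr[s Hs]]].
  exists (fun=> tdef); rewrite !big_nil mulr0 big1 ?mulr0// => t' _.
  by rewrite big_nil expr0n.
(* [f t0] is the cost of [t0] plus the penalty on the counts once [t0] is chosen *)
pose D t := \sum_(j <- r) ((s j == t)%:R - w j t).
pose f t0 := c i t0 + tau * \sum_t ((t0 == t)%:R - w i t + D t) ^+ 2.
have [t0 ft0] := average_attained f (w0 i) (w1 i).
exists (fun j => if j == i then t0 else s j).
rewrite !big_cons eqxx.
have -> : \sum_(j <- r) c j (if j == i then t0 else s j) = \sum_(j <- r) c j (s j).
  by apply: eq_big_seq => j jr; case: (j =P i) jr ir => // -> ->.
under eq_bigr => t _.
  rewrite big_cons eqxx.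
  have -> : \sum_(j <- r) (((if j == i then t0 else s j) == t)%:R - w j t) = D t.
    by apply: eq_big_seq => j jr; case: (j =P i) jr ir => // -> ->.
  over.
suff H : \sum_t0 w i t0 * f t0 <=
    \sum_t w i t * c i t + tau * (\sum_t D t ^+ 2) + tau.
  move: Hs ft0; rewrite -/D /f -natr1 mulrDr mulr1; lra.
rewrite /f.
under eq_bigr do rewrite mulrDr.
rewrite big_split -addrA lerD2l.
under eq_bigr do rewrite mulrCA.
rewrite -mulr_sumr -[X in _ + X](mulr1 tau) -mulrDr ler_wpM2l//.
(* the expectation of the squares, coordinate by coordinate *)
under eq_bigr do rewrite mulr_sumr.
rewrite exchange_big /= -[X in _ <= _ + X](w1 i) -big_split ler_sum// => t _.
have -> : \sum_t1 w i t1 * ((t1 == t)%:R - w i t + D t) ^+ 2 =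
    D t ^+ 2 + w i t * (1 - w i t).
  pose e := D t - w i t.
  have h t1 : w i t1 * ((t1 == t)%:R - w i t + D t) ^+ 2 =
      w i t1 * e ^+ 2 + (t1 == t)%:R * (w i t1 * (1 + 2 * e)).
    by rewrite /e; case: eqP => _ /=; ring.
  rewrite (eq_bigr _ (fun t1 _ => h t1)) big_split /= -mulr_suml w1.
  rewrite (bigD1 t)//= eqxx big1 ?addr0 => [|t1 /negPf->]; last by rewrite mul0r.
  rewrite /e /=; ring.
by rewrite lerD2l /= ler_piMr// lerBlDr lerDl.
Qed.

End RandomWalk.

Section Matching.
(** In a permutation with as few mismatches as possible, no value [t] is
    missed on both sides: a point with [f j0 = t] not sent to a [t] and a point
    with [f l != t] sent to a [t] could be improved by a transposition. So the
    mismatches at [t] number exactly the excess of [t] among the values of [f]. *)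
Lemma matching (I T : finType) (f g : I -> T) : exists s : {perm I},
  (#|[pred j | f j != g (s j)]| <= \sum_t (#|[pred j | f j == t]| - #|[pred j | g j == t]|))%N.
Proof.
pose m (s : {perm I}) := #|[pred j | f j != g (s j)]|.
have [s _ smin] := @arg_minnP _ 1%g xpredT m isT; exists s.
have -> : #|[pred j | f j != g (s j)]| =
    (\sum_t #|[pred j | (f j == t) && (g (s j) != t)]|)%N.
  rewrite -sum1_card (partition_big f xpredT)//=; apply: eq_bigr => t _.
  rewrite -sum1_card; apply: eq_bigl => j; rewrite !inE andbC.
  by case: (f j =P t) => //= ->; rewrite eq_sym.
apply: leq_sum => t _.
have [->//|/card_gt0P[j0]] := posnP #|[pred j | (f j == t) && (g (s j) != t)]|.
rewrite inE => /andP[/eqP fj0 gj0].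
(* otherwise exchanging the images of [j0] and [l] removes a mismatch *)
have sub l : g (s l) == t -> f l == t.
  move=> /eqP gl; apply: contraT => fl.
  have := smin (tperm j0 l * s)%g isT; rewrite leqNgt => /negP[].
  apply: proper_card; apply/properP; split.
    apply/fintype.subsetP => j; rewrite !inE permM.
    by case: tpermP => [->|->|//]; rewrite ?fj0 ?gl ?eqxx// eq_sym.
  by exists j0; rewrite !inE ?permM ?tpermL fj0 ?gl ?eqxx// eq_sym.
have -> : #|[pred j | g j == t]| = #|[pred j | (f j == t) && (g (s j) == t)]|.
  rewrite -!sum1_card (reindex_inj (@perm_inj _ s)); apply: eq_bigl => j.
  by rewrite !inE; case: eqP => [/eqP/sub->|]; rewrite ?andbF.
rewrite -(cardID [pred j | g (s j) == t] [pred j | f j == t]) addnC.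
rewrite (_ : #|[predI _ & _]| = #|[pred j | (f j == t) && (g (s j) == t)]|); last first.
  by apply: eq_card => j; rewrite !inE andbC.
rewrite addnK; apply/eq_leq/eq_card => j; by rewrite !inE andbC.
Qed.
End Matching.

Section EigenvalueMatching.
Variable R : realType.
Local Notation C := R[i].

Definition average n (f : 'I_n -> C) : C := (\sum_j f j) / n%:R.

Lemma normc_sqrD (y z : C) : normc (y + z) ^+ 2 <= 2 * normc y ^+ 2 + 2 * normc z ^+ 2.
Proof.
rewrite !sqr_normc; case: y z => a b [c d] /=.
have := sqr_ge0 (a - c); have := sqr_ge0 (b - d); nra.
Qed.

Lemma card_sum_natr (I : finType) (P : pred I) : #|P|%:R = \sum_i (P i)%:R :> R.
Proof.
rewrite -sum1_card natr_sum big_mkcond; apply: eq_bigr => i _.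
by rewrite unfold_in; case: (P i).
Qed.

(** Rounding with respect to the walk, with the weight [N] on the counts: both
    the transport cost and the deviation of the counts from the averages of
    the kernel are controlled. *)
Lemma kernel_rounding (N n : nat) (T : finType) (p : T -> C) (W : T -> C -> R)
    (la : 'I_n -> C) : (0 < N)%N -> (0 < n)%N -> walk_kernel N p W ->
  (forall j, normc (la j) = 1) ->
  exists s : 'I_n -> T,
    \sum_j normc (la j - p (s j) / N%:R) ^+ 2 <= 4 * n%:R / N%:R /\
    forall t, `|#|[pred j | s j == t]|%:R - \sum_j W t (la j)| <= 2 * Num.sqrt n%:R.
Proof.
move=> N0 n0 Wz la1; pose w j t := W t (la j).
pose c j t := normc (N%:R * la j - p t) ^+ 2.
have tdef : T.
  case: (pickP (mem T)) => [//|T0].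
  have [_] := Wz _ (la1 (Ordinal n0)).
  by rewrite big_pred0 // => /eqP; rewrite eq_sym oner_eq0.
have [j t|j|s] := @greedy_rounding R _ _ w c N%:R tdef (index_enum 'I_n)
  (index_enum_uniq _) (ler0n _ _).
- by have [+ _ _] := Wz _ (la1 j); apply.
- by have [] := Wz _ (la1 j).
have EC j : \sum_t w j t * c j t = 3 * N%:R by have [_ _] := Wz _ (la1 j).
rewrite (eq_bigr _ (fun j _ => EC j)).
rewrite [size _](_ : _ = n) => [|]; last first.
  by apply: etrans (card_ord n); rewrite -sum1_card -sum1_size; exact: eq_bigl.
rewrite sumr_const card_ord -[_ *+ n]mulr_natr.
set D := \sum_t (\sum_(i <- _) _) ^+ 2 => H.
have NR : (0 : R) < N%:R by rewrite ltr0n.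
have D0 : 0 <= D by apply: sumr_ge0 => t _; exact: sqr_ge0.
have c0 : 0 <= \sum_j c j (s j) by apply: sumr_ge0 => t _; exact: sqr_ge0.
exists s; split=> [|t].
  have -> : \sum_j normc (la j - p (s j) / N%:R) ^+ 2 = (\sum_j c j (s j)) / N%:R ^+ 2.
    rewrite mulr_suml; apply: eq_bigr => j _.
    have -> : la j - p (s j) / N%:R = (N%:R * la j - p (s j)) / (N%:R : R)%:C%C.
      by rewrite rmorph_nat mulrBl mulrAC divff ?mul1r// pnatr_eq0 -lt0n.
    by rewrite normcM normcV normcR ger0_norm ?ler0n// exprMn exprVn.
  rewrite ler_pdivrMr ?exprn_gt0//.
  have -> : 4 * n%:R / N%:R * N%:R ^+ 2 = 4 * n%:R * N%:R :> R.
    by field; rewrite lt0r_neq0.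
  have := mulr_ge0 (ltW NR) D0; lra.
have {}H : D <= 4 * n%:R.
  rewrite -(ler_pM2l NR); lra.
rewrite -ler_sqr ?nnegrE ?mulr_ge0 ?sqrtr_ge0// exprMn sqr_sqrtr ?ler0n//.
rewrite real_normK ?num_real//.
apply: le_trans (_ : D <= _); last by lra.
rewrite /D (bigD1 t)//= sumrB -card_sum_natr.
by rewrite lerDl sumr_ge0// => t' _; exact: sqr_ge0.
Qed.

(** Both lists are rounded to the positions of the walk, and the indices with
    equal positions are matched. The number of unmatched indices is governed by
    the difference of the averages of [W t]; as the eigenvalues lie on the unit
    circle, an unmatched pair costs at most [4]. *)
Lemma matching_estimate (N n : nat) (T : finType) (p : T -> C) (W : T -> C -> R)
    (la mu : 'I_n -> C) : (0 < N)%N -> (0 < n)%N -> walk_kernel N p W ->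
  (forall j, normc (la j) = 1) -> (forall j, normc (mu j) = 1) ->
  exists s : {perm 'I_n}, (\sum_j normc (la j - mu (s j)) ^+ 2) / n%:R <=
    16 / N%:R + 4 * \sum_t (4 * (Num.sqrt n%:R)^-1 +
      `|(\sum_j W t (la j)) / n%:R - (\sum_j W t (mu j)) / n%:R|).
Proof.
move=> N0 n0 Wz la1 mu1.
have [f [fla fW]] := kernel_rounding N0 n0 Wz la1.
have [g [gmu gW]] := kernel_rounding N0 n0 Wz mu1.
have [s sfg] := matching f g; exists s.
have NR : (0 : R) < N%:R by rewrite ltr0n.
have nR : (0 : R) < n%:R by rewrite ltr0n.
have term j : normc (la j - mu (s j)) ^+ 2 <=
    2 * normc (la j - p (f j) / N%:R) ^+ 2 +
    2 * normc (mu (s j) - p (g (s j)) / N%:R) ^+ 2 + 4 * (f j != g (s j))%:R.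
  case: eqP => [->|_] /=.
    rewrite mulr0 addr0; set q := p _ / _.
    have -> : la j - mu (s j) = (la j - q) + - (mu (s j) - q).
      by rewrite opprB addrA subrK.
    by apply: le_trans (normc_sqrD _ _) _; rewrite normcN.
  apply: le_trans (normc_sqrD _ _) _; rewrite normcN la1 mu1 !expr1n.
  by rewrite ler_wpDl ?addr_ge0 ?mulr_ge0 ?normc_ge0// !mulr1 -natrD.
have mis : \sum_j (f j != g (s j))%:R <= \sum_t (4 * Num.sqrt n%:R +
    `|\sum_j W t (la j) - \sum_j W t (mu j)|).
  rewrite -card_sum_natr.
  apply: (@le_trans _ _ (\sum_t (#|[pred j | f j == t]| - #|[pred j | g j == t]|)%N%:R)).
    by rewrite -natr_sum ler_nat.
  apply: ler_sum => t _.
  apply: (@le_trans _ _ `|#|[pred j | f j == t]|%:R - #|[pred j | g j == t]|%:R|).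
    by case: (leqP #|[pred j | g j == t]| #|[pred j | f j == t]|) => h;
      [rewrite natrB// ler_norm | rewrite (eqP (ltnW h)) normr_ge0].
  have := fW t; have := gW t; rewrite !ler_norml; set a := #|_|%:R; set b := #|_|%:R.
  set A := \sum_j W t (la j); set B := \sum_j _.
  have := ler_norm (A - B); have := ler_norm (- (A - B)); rewrite normrN.
  set e := `|A - B|; set r := Num.sqrt _ => h1 h2 /andP[h3 h4] /andP[h5 h6].
  by apply/andP; split; lra.
rewrite ler_pdivrMr//; apply: le_trans (ler_sum _ (fun j _ => term j)) _.
rewrite [leLHS]big_split /= [X in X + _ <= _]big_split /= -!mulr_sumr.
have -> : \sum_j normc (mu (s j) - p (g (s j)) / N%:R) ^+ 2 =
    \sum_j normc (mu j - p (g j) / N%:R) ^+ 2.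
  by rewrite [RHS](reindex_inj (@perm_inj _ s)).
set S := \sum_t (_ + _).
have -> : (16 / N%:R + 4 * S) * n%:R = 16 / N%:R * n%:R + 4 * (S * n%:R) by ring.
rewrite /S mulr_suml.
rewrite lerD//; first by move: fla gmu; lra.
rewrite ler_wpM2l//; apply: le_trans mis _; apply: ler_sum => t _.
rewrite [leRHS]mulrDl lerD//.
  rewrite -mulrA ler_wpM2l// -[X in _^-1 * X]sqr_sqrtr ?ler0n// expr2 mulKf//.
  by rewrite lt0r_neq0// sqrtr_gt0.
by rewrite -mulrBl normrM normfV (ger0_norm (ler0n _ _)) divfK// lt0r_neq0.
Qed.

(** The averages of a trigonometric polynomial over a list of points of the
    circle depend only on the moments of the list, negative moments being the
    conjugates of positive ones. *)
Lemma trig_poly_average (F : C -> R) : trig_poly F ->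
  exists d (P : {poly C}), forall n (la : 'I_n -> C), (forall j, normc (la j) = 1) ->
    ((\sum_j F (la j)) / n%:R)%:C%C =
    \sum_(i < size P) P`_i * (if (d <= i)%N then average (fun j => la j ^+ (i - d))
                             else conjc (average (fun j => la j ^+ (d - i)))).
Proof.
move=> [d [P FP]]; exists d, P => n la la1.
have FE z : normc z = 1 -> (F z)%:C%C = \sum_(i < size P) P`_i *
   (if (d <= i)%N then z ^+ (i - d) else conjc (z ^+ (d - i))).
  move=> z1; have zz : conjc z * z = 1 by rewrite mul_conjc z1 expr1n.
  have -> : (F z)%:C%C = P.[z] * conjc z ^+ d.
    by rewrite -FP// -mulrA -exprMn [z * _]mulrC zz expr1n mulr1.
  rewrite horner_coef mulr_suml; apply: eq_bigr => i _; rewrite -mulrA; congr (_ * _).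
  case: leqP => [di|/ltnW di].
    by rewrite -{1}(subnK di) exprD -mulrA -exprMn [z * _]mulrC zz expr1n mulr1.
  by rewrite -{1}(subnK di) exprD mulrCA -exprMn [z * _]mulrC zz expr1n mulr1 rmorphXn.
rewrite rmorphM fmorphV rmorph_nat rmorph_sum.
rewrite (eq_bigr _ (fun j _ => FE _ (la1 j))) exchange_big mulr_suml /=.
apply: eq_bigr => i _; rewrite -mulr_sumr -mulrA; congr (_ * _).
case: ifP => // _; rewrite /average rmorphM fmorphV rmorph_nat rmorph_sum//.
Qed.

Variable omega : free_ultrafilter nat.

Lemma real_complexB (x y : R) : (x - y)%:C%C = x%:C%C - y%:C%C.
Proof. exact: rmorphB. Qed.

Lemma trig_poly_lim (F : C -> R) (n : nat -> nat) (la mu : forall k, 'I_(n k) -> C) :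
  trig_poly F ->
  (forall k j, normc (la k j) = 1) -> (forall k j, normc (mu k j) = 1) ->
  (forall m, ultra_lim omega (fun k => average (fun j => la k j ^+ m)
                                      - average (fun j => mu k j ^+ m)) 0) ->
  `|(\sum_j F (la k j)) / (n k)%:R - (\sum_j F (mu k j)) / (n k)%:R|
    @[k --> (omega : set_system nat)] --> (0 : R).
Proof.
move=> /trig_poly_average[d [P FP]] la1 mu1 mom.
pose D m k := normc (average (fun j => la k j ^+ m) - average (fun j => mu k j ^+ m) - 0).
apply: (@dominated_cvg0 _ _ _ (fun k =>
  \sum_(i < size P) normc P`_i * D ((i - d) + (d - i))%N k)); last first.
  by apply: cvg0_sum => i; apply: cvg0Z; exact: mom.
move=> k; rewrite normr_ge0 -normcR real_complexB FP// FP// -sumrB /=.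
apply: le_trans (normc_sum _) _; apply: ler_sum => i _.
rewrite -mulrBr normcM ler_wpM2l ?normc_ge0// /D subr0.
case: leqP => [di|/ltnW di].
  by rewrite (eqP di) addn0.
by rewrite (eqP di) add0n -rmorphB normc_conj.
Qed.

Lemma dimension_unbounded (n : nat -> nat) (M : R) : n @ \oo --> \oo ->
  \forall k \near (omega : set_system nat), M < (n k)%:R.
Proof.
move=> noo; pose m := (Num.truncn M).+1.
have [N _ Nm] := noo (fun i => m <= i)%N (ex_intro2 _ _ m I (fun i => id)).
apply: filterS (free_ultrafilter_large omega N) => k /Nm /= mn.
by apply: lt_le_trans (truncnS_gt M) _; rewrite ler_nat.
Qed.

Lemma dimension_sqrtV_cvg0 (n : nat -> nat) : n @ \oo --> \oo ->
  (Num.sqrt (n k)%:R)^-1 @[k --> (omega : set_system nat)] --> (0 : R).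
Proof.
move=> noo; apply/cvgrPdist_lt => e e0.
apply: filterS (dimension_unbounded (e ^- 2) noo) => k nk.
have n0 : (0 : R) < (n k)%:R by apply: le_lt_trans nk; rewrite invr_ge0 exprn_ge0 ?ltW.
rewrite sub0r normrN ger0_norm ?invr_ge0 ?sqrtr_ge0//.
rewrite invf_plt ?posrE ?sqrtr_gt0// -(ger0_norm (ltW e0)) -sqrtr_sqr -sqrtrV ?sqr_ge0//.
by rewrite ltr_sqrt.
Qed.

Lemma dimensionV_cvg0 (n : nat -> nat) : n @ \oo --> \oo ->
  (n k)%:R^-1 @[k --> (omega : set_system nat)] --> (0 : R).
Proof.
move=> noo; have s0 := dimension_sqrtV_cvg0 noo.
have -> : (fun k => (n k)%:R^-1 : R) =
    (fun k => (Num.sqrt (n k)%:R)^-1 * (Num.sqrt (n k)%:R)^-1).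
  by apply/funext => k; rewrite -invfM -expr2 sqr_sqrtr.
by rewrite -[0 in X in _ --> X](mulr0 0); exact: cvgM.
Qed.

(** In each dimension take the permutation of least cost. For fixed [N] the
    bound of [matching_estimate] tends to [16 / N] along [omega], because the
    moments agree in the limit, and [N] is arbitrary. *)
Lemma eigenvalue_matching (n : nat -> nat) (la mu : forall k, 'I_(n k) -> C) :
  (forall k, (0 < n k)%N) -> n @ \oo --> \oo ->
  (forall k j, normc (la k j) = 1) -> (forall k j, normc (mu k j) = 1) ->
  (forall m, ultra_lim omega (fun k => average (fun j => la k j ^+ m)
                                      - average (fun j => mu k j ^+ m)) 0) ->
  exists s : forall k, {perm 'I_(n k)},
    (\sum_j normc (la k j - mu k (s k j)) ^+ 2) / (n k)%:R
      @[k --> (omega : set_system nat)] --> (0 : R).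
Proof.
move=> n0 noo la1 mu1 mom.
pose cost k (s : {perm 'I_(n k)}) := (\sum_j normc (la k j - mu k (s j)) ^+ 2) / (n k)%:R.
pose s k := [arg min_(s < 1%g) cost k s]%O.
have smin k s' : cost k (s k) <= cost k s'.
  by rewrite /s; case: arg_minP => //= s0 _; apply.
exists s; apply/cvgrPdist_lt => e e0.
pose N := (Num.truncn (32 / e)).+1.
have NR : (0 : R) < N%:R by rewrite ltr0n.
have Ne : 16 / N%:R < e / 2.
  rewrite ltr_pdivrMr//; have := truncnS_gt (32 / e).
  by rewrite -/N ltr_pdivrMr// mulrC; lra.
have [T [p [W [Wp Wz]]]] := random_walk R N.
pose b k := 4 * \sum_t (4 * (Num.sqrt (n k)%:R)^-1 +
      `|(\sum_j W t (la k j)) / (n k)%:R - (\sum_j W t (mu k j)) / (n k)%:R|).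
have b0 : b k @[k --> (omega : set_system nat)] --> (0 : R).
  apply: cvg0Z; apply: cvg0_sum => t; apply: cvg0D.
    by apply: cvg0Z; exact: dimension_sqrtV_cvg0.
  exact: trig_poly_lim.
have e20 : 0 < e / 2 by rewrite divr_gt0.
move/cvgrPdist_lt: b0 => /(_ _ e20); apply: filterS => k.
rewrite !sub0r !normrN => bk.
have c0 : 0 <= cost k (s k) by rewrite divr_ge0// sumr_ge0// => j _; exact: sqr_ge0.
have [s' Hs'] := matching_estimate (isT : (0 < N)%N) (n0 k) Wz (la1 k) (mu1 k).
rewrite -[X in `|X|]/(cost k (s k)) ger0_norm//.
apply: le_lt_trans (smin k s') _; apply: le_lt_trans Hs' _.
by rewrite -/(b k); have := ler_norm (b k); lra.
Qed.

End EigenvalueMatching.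

(** * Conjugacy in the ultraproduct *)

Section Conjugacy.
Variables (R : realType) (omega : free_ultrafilter nat) (n : nat -> nat).
Local Notation C := R[i].
Local Notation cl := (@uclass R n omega).

Lemma ctraceE (u : uprod R n omega) i :
  ctrace u i = divisor_difference (fun m => utr (u ^+ m)) i.
Proof. by []. Qed.

Lemma ultra_lim_divisor_difference (f : nat -> nat -> C) (a : nat -> C) i :
  (forall m, ultra_lim omega (f m) (a m)) ->
  ultra_lim omega (fun k => divisor_difference (f ^~ k) i) (divisor_difference a i).
Proof. by move=> fa; apply: ultra_lim_sum => e; exact: ultra_limZ. Qed.

Lemma utrMC (a b : uprod R n omega) : utr (a * b) = utr (b * a).
Proof.
rewrite -[a]uclassK -[b]uclassK -!uclassM.
apply: (ultra_lim_unique (ultra_lim_utr omega _)).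
have E : (fun k => ntr ((urep a * urep b) k)) = (fun k => ntr ((urep b * urep a) k)).
  apply/funext => k; rewrite /ntr; congr (_ / _); exact: mxtrace_mulC.
rewrite E; exact: ultra_lim_utr.
Qed.

Lemma utr_conjugated (x y : uprod R n omega) m :
  conjugated x y -> utr (y ^+ m) = utr (x ^+ m).
Proof.
move=> [w [ww ww'] ->].
have -> : (w * x * ustar w) ^+ m = w * x ^+ m * ustar w.
  elim: m => [|m IHm]; first by rewrite !expr0 mulr1.
  by rewrite exprS IHm !mulrA -[_ * ustar w * w]mulrA ww mulr1 exprS !mulrA.
by rewrite utrMC mulrA ww mul1r.
Qed.

Lemma ctrace_perm_ge0 (p : uprod R n omega) i : uprod_perm p -> (0 < i)%N ->
  0 <= ctrace p i.
Proof.
move=> [x [px ->]] i0; rewrite ctraceE.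
apply: (ultra_lim_ge0 (ultra_lim_divisor_difference i
  (f := fun m k => ntr (x k ^+ m)) _)) => [m|k].
  exact: ultra_lim_utrX.
by have /is_perm_mxP[s ->] := px k; exact: divisor_difference_perm.
Qed.

Lemma unitary_perm_mx m (s : 'S_m) : unitary_mx (perm_mx s : 'M[C]_m).
Proof. by rewrite /unitary_mx /adjmx tr_perm_mx map_perm_mx -perm_mxM mulVg perm_mx1. Qed.

Lemma perm_mx_conj_diag m (s : 'S_m) (d : 'rV[C]_m) :
  perm_mx s *m diag_mx d *m adjmx (perm_mx s) = diag_mx (\row_j d 0 (s j)).
Proof.
rewrite /adjmx tr_perm_mx map_perm_mx.
rewrite -row_permE -col_permE; apply/matrixP => i j; rewrite !mxE.
by rewrite (inj_eq perm_inj).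
Qed.

Lemma ntr_diag_conjX m (U : 'M[C]_m) (d : 'rV[C]_m) r : unitary_mx U ->
  ntr ((adjmx U *m diag_mx d *m U) ^+ r) = average (fun j => d 0 j ^+ r).
Proof.
move=> uU.
have UU := unitary_mxC uU.
have -> : (adjmx U *m diag_mx d *m U) ^+ r = adjmx U *m diag_mx (\row_j d 0 j ^+ r) *m U.
  elim: r => [|r IHr].
    rewrite expr0 (_ : \row_j _ = const_mx 1); last by apply/rowP => j; rewrite !mxE.
    by rewrite diag_const_mx mulmx1 uU.
  rewrite exprS IHr -[LHS]/(_ *m _) !mulmxA -[_ *m U *m adjmx U]mulmxA UU mulmx1.
  rewrite -[_ *m diag_mx d *m diag_mx _]mulmxA mulmx_diag.
  by congr (_ *m diag_mx _ *m _); apply/rowP => j; rewrite !mxE exprS.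
rewrite /ntr mxtrace_mulC mulmxA UU mul1mx mxtrace_diag; congr (_ / _).
by apply: eq_bigr => j _; rewrite !mxE.
Qed.

(** [w] sends each eigenvector of the first matrix to the eigenvector of the
    second one that [s] pairs with it, so the difference becomes diagonal. *)
Lemma norm2_conj_matching m (U V : 'M[C]_m) (d e : 'rV[C]_m) (s : 'S_m) :
  unitary_mx U -> unitary_mx V ->
  let w := adjmx V *m perm_mx s^-1%g *m U in
  unitary_mx w /\
  norm2 (w *m (adjmx U *m diag_mx d *m U) *m adjmx w - adjmx V *m diag_mx e *m V)
    <= Num.sqrt ((\sum_j normc (d 0 j - e 0 (s j)) ^+ 2) / m%:R).
Proof.
move=> uU uV w.
have uP := unitary_perm_mx (s^-1)%g.
split; first by apply: unitary_mxM => //; apply: unitary_mxM => //; exact: unitary_mx_adj.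
have conjE P : adjmx V *m P *m U *m (adjmx U *m diag_mx d *m U)
    *m adjmx (adjmx V *m P *m U) = adjmx V *m (P *m diag_mx d *m adjmx P) *m V.
  by rewrite -[in RHS](unitary_mx_conjK (diag_mx d) uU) !adjmxM adjmxK !mulmxA.
rewrite /w conjE.
rewrite -mulmxBl -mulmxBr; apply: le_trans (norm2_unitary _ (unitary_mx_adj uV) uV) _.
rewrite perm_mx_conj_diag -raddfB norm2_diag (reindex_inj (@perm_inj _ s)) /=.
rewrite ler_wsqrtr// ler_wpM2r ?invr_ge0// le_eqVlt; apply/orP; left; apply/eqP.
by apply: eq_bigr => j _; rewrite !mxE permK.
Qed.

Lemma cvg0_sqrt (f : nat -> R) : (forall k, 0 <= f k) ->
  f k @[k --> (omega : set_system nat)] --> (0 : R) ->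
  Num.sqrt (f k) @[k --> (omega : set_system nat)] --> (0 : R).
Proof.
move=> f0 /cvgrPdist_lt fl; apply/cvgrPdist_lt => e e0.
have e20 : 0 < e ^+ 2 by rewrite exprn_gt0.
apply: filterS (fl _ e20) => k; rewrite !sub0r !normrN !ger0_norm ?sqrtr_ge0// => fe.
by rewrite -(ger0_norm (ltW e0)) -sqrtr_sqr ltr_sqrt.
Qed.

(** The normalized traces of the powers of a unitary matrix are the moments of
    its eigenvalue list, so [eigenvalue_matching] applies to the lists of [x k]
    and [y k]. *)
Lemma conjugated_of_moments (x y : linfty R n) :
  (forall k, (0 < n k)%N) -> n @ \oo --> \oo ->
  (forall k, unitary_mx (x k)) -> (forall k, unitary_mx (y k)) ->
  (forall m, utr (cl x ^+ m) = utr (cl y ^+ m)) -> conjugated (cl x) (cl y).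
Proof.
move=> n0 noo ux uy xy.
have diag (z : linfty R n) : (forall k, unitary_mx (z k)) -> forall k,
    exists Ud : 'M[C]_(n k) * 'rV[C]_(n k), [/\ unitary_mx Ud.1,
      forall j, normc (Ud.2 0 j) = 1 & z k = adjmx Ud.1 *m diag_mx Ud.2 *m Ud.1].
  by move=> uz k; have [U [d ?]] := unitary_diagonalization (uz k); exists (U, d).
pose Ux k := sval (cid (diag x ux k)); pose Uy k := sval (cid (diag y uy k)).
have HUx k := svalP (cid (diag x ux k)); have HUy k := svalP (cid (diag y uy k)).
have [|||s sP] := @eigenvalue_matching R omega n
  (fun k j => (Ux k).2 0 j) (fun k j => (Uy k).2 0 j) n0 noo.
- by move=> k j; have [_ + _] := HUx k; apply.
- by move=> k j; have [_ + _] := HUy k; apply.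
- move=> m.
  have h := ultra_limD (ultra_lim_utrX omega x m)
    (ultra_limZ (-1) (ultra_lim_utrX omega y m)).
  move: h; rewrite xy mulN1r subrr; congr (ultra_lim _ _ _); apply/funext => k.
  have [uU _ ->] := HUx k; have [uV _ ->] := HUy k.
  by rewrite mulN1r !ntr_diag_conjX.
pose w k := adjmx (Uy k).1 *m perm_mx (s k)^-1%g *m (Ux k).1.
have uw k : unitary_mx (w k).
  have [uU _ _] := HUx k; have [uV _ _] := HUy k.
  by have [] := norm2_conj_matching (Ux k).2 (Uy k).2 (s k) uU uV.
pose W : linfty R n := Linfty (bounded_unitary uw).
exists (cl W).
  split; rewrite -uclass_star -uclassM -uclass1; congr uclass; apply: linftyP => k.
    exact: uw.
  exact: unitary_mxC.
rewrite -uclass_star -!uclassM; apply/esym/uclass_eqP.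
apply: (@null_squeeze _ _ _ (W * x * linfty_star W - y) (fun k =>
  Num.sqrt ((\sum_j normc ((Ux k).2 0 j - (Uy k).2 0 (s k j)) ^+ 2) / (n k)%:R))).
  move=> k; have [uU _ xE] := HUx k; have [uV _ yE] := HUy k.
  have [_] := norm2_conj_matching (Ux k).2 (Uy k).2 (s k) uU uV.
  by rewrite -xE -yE.
apply: cvg0_sqrt => // k; rewrite divr_ge0// sumr_ge0// => j _; exact: sqr_ge0.
Qed.

Lemma normc_utr_unitaryX (x : linfty R n) m :
  (forall k, unitary_mx (x k)) -> normc (utr (cl x ^+ m)) <= 1.
Proof.
move=> ux; apply: (ultra_lim_normc_le (ultra_lim_utrX omega x m)) => k.
apply: le_trans (ntr_opnorm _) _; apply: opnorm_unitary.
elim: m => [|m IHm]; first by rewrite expr0; rewrite /unitary_mx adjmx1 mulmx1.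
by rewrite exprS; exact: unitary_mxM.
Qed.

(** Use [c i] as the proportion of points on cycles of length [i]. These
    proportions add up to at most [1], since by inversion the sum of [c d] over
    the divisors of [N`!] is the trace of a unitary. The moments of the
    resulting permutations tend to the sum of [c d] over the divisors of [m],
    which by inversion is the [m]-th moment of [x]. *)
Lemma perm_of_nonneg_ctrace (x : linfty R n) :
  (forall k, (0 < n k)%N) -> n @ \oo --> \oo -> (forall k, unitary_mx (x k)) ->
  (forall i, (0 < i)%N -> 0 <= ctrace (cl x) i) ->
  exists p : linfty R n, [/\ forall k, is_perm_mx (p k), forall k, unitary_mx (p k)
    & forall m, utr (cl x ^+ m) = utr (cl p ^+ m)].
Proof.
move=> n0 noo ux c_ge0.
pose c i : R := if (0 < i)%N then complex.Re (ctrace (cl x) i) else 0.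
have cE i : (0 < i)%N -> ctrace (cl x) i = (c i)%:C%C.
  move=> i0; have := c_ge0 i i0; rewrite /c i0 lecE /= => /andP[/eqP im _].
  by case: (ctrace (cl x) i) im => a b /= ->.
have c0 i : 0 <= c i.
  rewrite /c; case: ifP => // i0; have := c_ge0 i i0.
  by rewrite lecE => /andP[].
have utrE m M : (0 < m <= M)%N ->
    utr (cl x ^+ m) = (\sum_(1 <= d < M.+1) c d * (d %| m)%:R)%:C%C.
  move=> mM; rewrite (divisor_difference_inversion (fun m => utr (cl x ^+ m)) mM).
  rewrite rmorph_sum /=; apply: eq_big_nat => d /andP[d0 _].
  by rewrite -ctraceE cE// -(rmorph_nat (real_complex R)) -rmorphM.
have c1 N : \sum_(1 <= d < N.+1) c d <= 1.
  have NM : (0 < N`! <= N`!)%N by rewrite fact_gt0 leqnn.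
  have := normc_utr_unitaryX N`! ux; rewrite (utrE _ _ NM) normcR => h.
  apply: le_trans (le_trans (ler_norm _) h).
  apply: (@le_trans _ _ (\sum_(1 <= d < N.+1) c d * (d %| N`!)%:R)).
    by apply: ler_sum_nat => d dN; rewrite dvdn_fact ?mulr1.
  rewrite [leRHS](@big_cat_nat _ _ _ N.+1)//= ?ltnS ?fact_geq//.
  by rewrite lerDl sumr_ge0// => d _; rewrite mulr_ge0.
pose s k := sval (cid (perm_of_cycle_proportions (n0 k) c0 (c1 (n k)))).
have sP k := svalP (cid (perm_of_cycle_proportions (n0 k) c0 (c1 (n k)))).
have up k : unitary_mx (perm_mx (s k) : 'M[C]_(n k)) by exact: unitary_perm_mx.
exists (Linfty (bounded_unitary up)); split=> [k|k|m].
- exact: perm_mx_is_perm.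
- exact: up.
have [->|m0] := posnP m; first by rewrite !expr0.
apply: ultra_lim_unique (ultra_lim_utrX omega _ _).
rewrite (utrE m m) ?m0 ?leqnn//; set S := \sum_(1 <= d < m.+1) _.
pose B : R := m%:R + \sum_(1 <= d < m.+1) d%:R.
apply: (@squeeze_cvgr _ _ _ _ (fun=> 0) (fun k => B * (n k)%:R^-1)).
- near=> k; rewrite normc_ge0 /=.
  have mn : (m <= n k)%N by rewrite -(ler_nat R) ltW//; near: k; exact: dimension_unbounded.
  have := sP k m; rewrite m0 mn => /(_ isT); apply: le_trans.
  have -> : ntr (Linfty (bounded_unitary up) k ^+ m) =
      ((fixed_points (s k ^+ m)%g)%:R / (n k)%:R : R)%:C%C.
    by rewrite [LHS]ntr_permX rmorphM fmorphV !rmorph_nat.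
  by rewrite -real_complexB normcR.
- exact: cvg_cst.
- by apply: cvg0Z; exact: dimensionV_cvg0.
Unshelve. all: by end_near. Qed.

End Conjugacy.

(* In R[i], 0 <= c means that c is real and nonnegative. *)
Theorem theorem3p3 (R : realType) (omega : free_ultrafilter nat)
    (n : nat -> nat) (n_gt0 : forall k, (0 < n k)%N) (n_infty : n @ \oo --> \oo)
    (u : uprod R n omega) (u_unitary : unitary u) :
  (exists2 p, uprod_perm p & conjugated u p) <->
  (forall i : nat, (0 < i)%N -> 0 <= ctrace u i).
Proof.
split=> [[p pp up] i i0|c_ge0].
  rewrite ctraceE (_ : (fun m => _) = (fun m => utr (p ^+ m))).
    by rewrite -ctraceE; exact: ctrace_perm_ge0.
  by apply/funext => m; rewrite (utr_conjugated m up).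
have [x [xu ux]] := unitary_lift u_unitary; rewrite -xu in c_ge0 *.
have [p [perm_p unitary_p moments]] := perm_of_nonneg_ctrace n_gt0 n_infty ux c_ge0.
exists (uclass omega p); first by exists p.
exact: conjugated_of_moments.
Qed.
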